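(* Let $\mathbf G=\mathbf T\ltimes\mathbf U$ with $\mathbf T$ a torus and $\mathbf U$ unipotent of nilpotency class $n$. Let $A=A^{\mathbf T}+A^{\mathbf U}$ be a formal connection with $A^{\mathbf T}=\sum_{j=-q}^{-1}A^{\mathbf T}_jt^j+\sum_{j=p}^\infty A^{\mathbf T}_jt^j\in\mathrm{Lie}(\mathbf T)_F$ for some $q,p\ge0$, and $A^{\mathbf U}=\sum_{j=m}^\infty A^{\mathbf U}_jt^j\in\mathrm{Lie}(\mathbf U)_F$, $m\in\mathbb Z$. Let $\chi_1,\dots,\chi_l$ be the weights of $\mathbf T$ on $\mathrm{Lie}(\mathbf U)$, let $b$ be a positive integer such that $\mu:=b\,\pi(A^{\mathbf T}_{-1})\in X_*(\mathbf T)$ (with $A^{\mathbf T}_{-1}=0$ if $q=0$), and put $L=\max\bigl(\{\tfrac1b\langle\mu,\chi_i\rangle\}_{i=1}^l\cup\{0\}\bigr)$. (i) Suppose that $m>L-1$. Then there exists $x\in\mathbf G(\mathcal O)$ such that $x\cdot A=\sum_{j=-q}^{-1}A^{\mathbf T}_jt^j$. More precisely, there exist $x_{\mathbf T}\in\mathbf T(\mathcal O)$ with $x_{\mathbf T}\equiv1\pmod{t^{p+1}}$ and $x_{\mathbf U}\in\mathbf U(\mathcal O)$ with $x_{\mathbf U}\equiv1\pmod{t^{m+1}}$ such that $(x_{\mathbf U}x_{\mathbf T})\cdot A=\sum_{j=-q}^{-1}A^{\mathbf T}_jt^j$. (ii) Suppose that $m\le L-1$. Then the $\mathbf G(F)$-gauge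 equivalence class of $A$ is determined by the coefficients $A^{\mathbf T}_j$ for $-q\le j<(n+1)(|m|-1)+L$ and $A^{\mathbf U}_j$ for $m\le j<n(|m|-1)+L$. More precisely, suppose that there are another connection $B=B^{\mathbf T}+B^{\mathbf U}$ (with $B^{\mathbf T}\in\mathrm{Lie}(\mathbf T)_F$, $B^{\mathbf U}\in\mathrm{Lie}(\mathbf U)_F$) and an integer $k\ge n(|m|-1)+L$ satisfying $A^{\mathbf T}\equiv B^{\mathbf T}\pmod{t^{k+|m|-1}}$ and $A^{\mathbf U}\equiv B^{\mathbf U}\pmod{t^k}$. Then there exists $x\in\mathbf G(\mathcal O)$ with $x\equiv1\pmod{t^{k-n|m|+n+1}}$ such that $x\cdot A=B$.
   Context: $\mathbf k$ is an algebraically closed field of characteristic $0$; $\mathcal O=\mathbf k[[t]]$, $F=\mathbf k((t))$; $\mathfrak g=\mathrm{Lie}(\mathbf G)=\mathrm{Lie}(\mathbf T)\oplus\mathrm{Lie}(\mathbf U)$; a subscript $F$ or $\mathcal O$ on a Lie algebra denotes base change from $\mathbf k$. A connection is an element of $\mathfrak g_F$. The gauge action of $\mathbf G(F)$ on $\mathfrak g_F$ is $x\cdot A=\mathrm{Ad}(x)A+\frac{dx}{dt}x^{-1}$ (computed in any faithful representation). Congruences mod $t^k$ of connections are modulo $t^k\mathfrak g_{\mathcal O}$; for $x\in\mathbf G(\mathcal O)$, $x\equiv1\pmod{t^k}$ means $x\mapsto1$ in $\mathbf G(\mathcal O/t^k)$. Fix a $\mathbb Q$-linear map $\pi:\mathbf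 k\to\mathbb Q$ with $\pi(1)=1$, extended to $\pi:\mathrm{Lie}(\mathbf T)\cong X_*(\mathbf T)\otimes\mathbf k\to X_*(\mathbf T)\otimes\mathbb Q$, where $X_*(\mathbf T)$ is the cocharacter lattice; $\langle-,-\rangle$ is the pairing of cocharacters and characters. The weights $\chi_i$ are the characters in the weight decomposition $\mathrm{Lie}(\mathbf U)=\bigoplus_{i=1}^l\mathfrak u_{\chi_i}$ under the adjoint action of $\mathbf T$. The nilpotency class is the length of the upper central series normalized so that commutative unipotent groups have class $0$, and a noncommutative $\mathbf U$ has class one more than $\mathbf U/Z_{\mathbf U}$, where $Z_{\mathbf U}$ is the center of $\mathbf U$.
   Formalization: Part (ii) is proved only for m ≠ 0: for m = 0 ≤ L−1 it fails as printed, e.g. for B^U = A^U and B^T = A^T + c t^{k−1} with c ≠ 0, k ≥ 1 and k ≥ L−n, where no x ≡ 1 mod t^{k+n+1} has x·A = B. *)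

(* Defs.v *)
From HB Require Import structures.
From mathcomp Require Import all_boot all_order all_algebra.
From mathcomp Require Import mpoly zify.
From mathcomp Require Import boolp classical_sets fsbigop.

Set Implicit Arguments.
Unset Strict Implicit.
Unset Printing Implicit Defensive.

Import Order.TTheory GRing.Theory Num.Theory.
Local Open Scope ring_scope.

(* The field k((t)): the series sum_j (f j) t^j is represented by its
   coefficient function f : int -> k, which vanishes far enough to the left. *)
Record laurent (k : fieldType) := Laurent {
  lcoef :> int -> k;
  lcoef_bounded : exists a : int, forall j : int, j < a -> lcoef j = 0
}.

HB.instance Definition _ (k : fieldType) := gen_eqMixin (laurent k).
HB.instance Definition _ (k : fieldType) := gen_choiceMixin (laurent k).

Section LaurentRing.
Variable k : fieldType.
Implicit Types f g h : laurent k.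
Local Notation F := (laurent k).

Definition lsupp f (a : int) := forall j : int, j < a -> f j = 0.

Lemma lsupp_ex f : exists a, lsupp f a.
Proof. exact: lcoef_bounded. Qed.

Lemma lsuppW f a b : b <= a -> lsupp f a -> lsupp f b.
Proof. by move=> ba fa j jb; apply: fa; apply: lt_le_trans jb ba. Qed.

Lemma laurentP f g : (forall j, f j = g j) -> f = g.
Proof.
case: f g => [f fb] [g gb] /= /funext fg; case: _ / fg in gb *.
by congr Laurent; apply: Prop_irrelevance.
Qed.

Lemma lzero_bdd : exists a : int, forall j : int, j < a -> (0 : k) = 0.
Proof. by exists 0. Qed.
Definition lzero : F := Laurent lzero_bdd.

Lemma lopp_bdd f : exists a : int, forall j : int, j < a -> - f j = 0.
Proof. by have [a fa] := lsupp_ex f; exists a => j /fa ->; rewrite oppr0. Qed.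
Definition lopp f : F := Laurent (lopp_bdd f).

Lemma ladd_bdd f g : exists a : int, forall j : int, j < a -> f j + g j = 0.
Proof.
have [[a fa] [b gb]] := (lsupp_ex f, lsupp_ex g).
exists (Num.min a b) => j; rewrite lt_min => /andP[/fa -> /gb ->].
by rewrite addr0.
Qed.
Definition ladd f g : F := Laurent (ladd_bdd f g).

Lemma lscale_bdd (c : k) f : exists a : int, forall j : int, j < a -> c * f j = 0.
Proof. by have [a fa] := lsupp_ex f; exists a => j /fa ->; rewrite mulr0. Qed.
Definition lscale c f : F := Laurent (lscale_bdd c f).

Lemma lmono_bdd (c : k) (d : int) :
  exists a : int, forall j : int, j < a -> (if j == d then c else 0) = 0.
Proof. by exists d => j; case: eqP => // ->; rewrite ltxx. Qed.
(* The monomial c t^d. *)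
Definition lmono c d : F := Laurent (lmono_bdd c d).

(* Only finitely many terms of this sum are nonzero, see [lconvE]. *)
Definition lconv f g (j : int) : k :=
  \sum_(i \in [set: int]%classic) f i * g (j - i).

Lemma lconvE f g a b (n : nat) j : lsupp f a -> lsupp g b -> j < a + b + n%:Z ->
  lconv f g j = \sum_(i < n) f (a + i%:Z) * g (j - (a + i%:Z)).
Proof.
move=> fa gb jn; rewrite /lconv.
rewrite (fsbigE [seq a + i%:Z | i <- iota 0 n]) //.
- rewrite (eq_bigl xpredT) => [|i]; last by rewrite in_setT.
  by rewrite big_map -(big_mkord xpredT (fun i => f (a + i%:Z) * g (j - (a + i%:Z))))
             /index_iota subn0.
- by rewrite map_inj_uniq ?iota_uniq // => x y; lia.
move=> i _ ir; case: (ltP i a) => [/fa ->|ai]; first by rewrite mul0r.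
rewrite [X in _ * X]gb ?mulr0 //.
rewrite ltNge; apply: contra ir => jb; apply/mapP; exists `|(i - a)%R|%N; last by lia.
by rewrite mem_iota; lia.
Qed.

Lemma lconv_supp f g a b j : lsupp f a -> lsupp g b -> j < a + b -> lconv f g j = 0.
Proof. by move=> fa gb jn; rewrite (lconvE (n := 0) fa gb) ?big_ord0 ?addr0. Qed.

Lemma lmul_bdd f g : exists a : int, forall j : int, j < a -> lconv f g j = 0.
Proof.
have [[a fa] [b gb]] := (lsupp_ex f, lsupp_ex g).
by exists (a + b) => j; apply: lconv_supp.
Qed.
Definition lmul f g : F := Laurent (lmul_bdd f g).

Lemma lmul_supp f g a b : lsupp f a -> lsupp g b -> lsupp (lmul f g) (a + b).
Proof. by move=> fa gb j; apply: lconv_supp. Qed.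

Definition ltr f (a : int) (n : nat) : {poly k} := \poly_(i < n.+1) f (a + i%:Z).

Lemma lmul_coef f g a b (n M : nat) : lsupp f a -> lsupp g b -> (n <= M)%N ->
  lmul f g (a + b + n%:Z) = (ltr f a M * ltr g b M)`_n.
Proof.
move=> fa gb nM; rewrite /= (lconvE (n := n.+1) fa gb); last by lia.
rewrite coefM; apply: eq_bigr => i _; rewrite !coef_poly.
have le_in : (i <= n)%N by rewrite -ltnS.
rewrite !ifT; [|lia|lia].
by congr (_ * g _); lia.
Qed.

Lemma laurent_shiftP f g a : lsupp f a -> lsupp g a ->
  (forall n : nat, f (a + n%:Z) = g (a + n%:Z)) -> f = g.
Proof.
move=> fa ga fg; apply: laurentP => j; case: (ltP j a) => [ja|aj].
  by rewrite fa ?ga.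
by have -> : j = a + `|(j - a)%R|%N%:Z by lia.
Qed.

Lemma coefM_eq (p q p' q' : {poly k}) n :
  (forall i, (i <= n)%N -> p`_i = p'`_i) -> (forall i, (i <= n)%N -> q`_i = q'`_i) ->
  (p * q)`_n = (p' * q')`_n.
Proof.
move=> pp qq; rewrite !coefM; apply: eq_bigr => i _.
by rewrite pp ?qq //; [rewrite leq_subr|rewrite -ltnS].
Qed.

Lemma ladd0 : left_id lzero ladd.
Proof. by move=> f; apply: laurentP => j /=; rewrite add0r. Qed.
Lemma laddC : commutative ladd.
Proof. by move=> f g; apply: laurentP => j /=; rewrite addrC. Qed.
Lemma laddA : associative ladd.
Proof. by move=> f g h; apply: laurentP => j /=; rewrite addrA. Qed.
Lemma laddN : left_inverse lzero lopp ladd.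
Proof. by move=> f; apply: laurentP => j /=; rewrite addNr. Qed.

HB.instance Definition _ := GRing.isZmodule.Build F laddA laddC ladd0 laddN.

Lemma lmulC : commutative lmul.
Proof.
move=> f g; have [[a fa] [b gb]] := (lsupp_ex f, lsupp_ex g).
apply: (@laurent_shiftP _ _ (a + b)); first exact: lmul_supp.
  by rewrite addrC; exact: lmul_supp.
move=> n; rewrite (lmul_coef fa gb (leqnn n)) mulrC.
by rewrite [a + b]addrC (lmul_coef gb fa (leqnn n)).
Qed.

Lemma lmulA : associative lmul.
Proof.
move=> f g h.
have [[[a fa] [b gb]] [c hc]] := (lsupp_ex f, lsupp_ex g, lsupp_ex h).
have [fg gh] := (lmul_supp fa gb, lmul_supp gb hc).
apply: (@laurent_shiftP _ _ (a + b + c)) => [||n].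
- by rewrite -addrA; exact: lmul_supp.
- exact: lmul_supp.
- rewrite -[in LHS](addrA a b c) (lmul_coef fa gh (leqnn n)).
  rewrite (lmul_coef fg hc (leqnn n)).
  rewrite (@coefM_eq _ _ (ltr f a n) (ltr g b n * ltr h c n)) //; last first.
    move=> i le_in; rewrite [LHS]coef_poly ltnS le_in.
    exact: lmul_coef.
  rewrite mulrA; apply: coefM_eq => // i le_in.
  rewrite [RHS]coef_poly ltnS le_in; apply/esym.
  exact: lmul_coef.
Qed.

Lemma lmono_supp c d : lsupp (lmono c d) d.
Proof. by move=> j /=; case: eqP => // ->; rewrite ltxx. Qed.

Lemma lmono_mulE c d f j : lmul (lmono c d) f j = c * f (j - d).
Proof.
have [b fb] := lsupp_ex f.
have E := lconvE (n := `|(j - d - b)%R|%N.+1) (@lmono_supp c d) fb.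
rewrite /= E; last by lia.
rewrite big_ord_recl big1 ?addr0 /= ?eqxx ?addr0 // => i _.
by rewrite ifF ?mul0r //; apply/negbTE; rewrite /bump /=; lia.
Qed.

Lemma lmul1 : left_id (lmono 1 0) lmul.
Proof. by move=> f; apply: laurentP => j; rewrite lmono_mulE mul1r subr0. Qed.

Lemma lmulDl : left_distributive lmul ladd.
Proof.
move=> f g h; have [[[a fa] [b gb]] [c hc]] := (lsupp_ex f, lsupp_ex g, lsupp_ex h).
set d := Num.min a b.
have fd : lsupp f d by apply: lsuppW fa; rewrite ge_min lexx.
have gd : lsupp g d by apply: lsuppW gb; rewrite ge_min lexx orbT.
have fgd : lsupp (ladd f g) d by move=> j jd /=; rewrite fd ?gd ?addr0.
apply: laurentP => j /=.
have jn : j < d + c + `|(j - d - c)%R|%N.+1%:Z by lia.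
rewrite (lconvE fgd hc jn) (lconvE fd hc jn) (lconvE gd hc jn) -big_split /=.
by apply: eq_bigr => i _; rewrite mulrDl.
Qed.

Lemma lone_neq0 : lmono 1 0 != 0 :> F.
Proof.
apply/eqP => /(congr1 (fun f : F => f 0)) /=.
by move/eqP; rewrite oner_eq0.
Qed.

HB.instance Definition _ := GRing.Zmodule_isComNzRing.Build F
  lmulA lmulC lmul1 lmulDl lone_neq0.

Lemma lscaleA a b f : lscale a (lscale b f) = lscale (a * b) f.
Proof. by apply: laurentP => j /=; rewrite mulrA. Qed.
Lemma lscale1 : left_id 1 lscale.
Proof. by move=> f; apply: laurentP => j /=; rewrite mul1r. Qed.
Lemma lscaleDr : right_distributive lscale +%R.
Proof. by move=> c f g; apply: laurentP => j /=; rewrite mulrDr. Qed.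
Lemma lscaleDl f : {morph lscale^~ f : a b / a + b}.
Proof. by move=> a b; apply: laurentP => j /=; rewrite mulrDl. Qed.

HB.instance Definition _ := GRing.Zmodule_isLmodule.Build k F
  lscaleA lscale1 lscaleDr lscaleDl.

Lemma lscaleE c f : c *: f = lmono c 0 * f.
Proof. by apply: laurentP => j; rewrite [RHS]lmono_mulE subr0. Qed.

Lemma lscaleAl c f g : c *: (f * g) = (c *: f) * g.
Proof. by rewrite !lscaleE mulrA. Qed.

HB.instance Definition _ := GRing.Lmodule_isLalgebra.Build k F lscaleAl.
HB.instance Definition _ := GRing.Lalgebra_isComAlgebra.Build k F.

(* The inverse of the power series sum_i (c i) t^i when c 0 <> 0. *)
Section Inverse.
Variables (c : nat -> k).
Fixpoint invs (n : nat) : seq k :=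
  if n is n'.+1 then
    rcons (invs n')
      ((c 0%N)^-1 * ((n' == 0%N)%:R - \sum_(i < n') c (n' - i)%N * (invs n')`_i))
  else [::].

Lemma size_invs n : size (invs n) = n.
Proof. by elim: n => //= n IHn; rewrite size_rcons IHn. Qed.

Lemma nth_invs n i : (i < n)%N -> (invs n)`_i = (invs i.+1)`_i.
Proof.
elim: n => // n IHn; rewrite ltnS leq_eqVlt => /predU1P[->//|lt_in].
by rewrite -IHn //= nth_rcons size_invs lt_in.
Qed.

Definition invc n := (invs n.+1)`_n.

Lemma invcP n : c 0%N != 0 -> \sum_(i < n.+1) c (n - i)%N * invc i = (n == 0%N)%:R.
Proof.
move=> c0; rewrite big_ord_recr /= subnn {2}/invc /= nth_rcons size_invs ltnn eqxx.
rewrite mulrA mulfV // mul1r addrC -[RHS]addr0 -addrA; congr (_ + _).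
apply/eqP; rewrite addrC subr_eq0; apply/eqP; apply: eq_bigr => i _.
by rewrite /invc [in RHS]nth_invs.
Qed.
End Inverse.

Lemma laurent_inv_ex f : f != 0 -> exists g, g * f = 1.
Proof.
move=> f0; have [a fa] := lsupp_ex f.
have [n fn0] : exists n : nat, f (a + n%:Z) != 0.
  apply: contra_neqP f0 => /forallNP f0; apply: (@laurent_shiftP _ _ a) => // n.
  by apply/eqP; apply: contrapT => /negP; apply: f0.
have [{fn0}n fn0 nmin] := ex_minnP (ex_intro (fun n : nat => f (a + n%:Z) != 0) n fn0).
set v := a + n%:Z.
have fv : lsupp f v.
  move=> j jv; case: (ltP j a) => [/fa //|aj].
  apply/eqP; apply: contraTT jv => fj; rewrite -leNgt /v.
  have Ej : j = a + `|(j - a)%R|%N%:Z by lia.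
  by rewrite Ej in fj; have := nmin _ fj; lia.
pose c i := f (v + i%:Z).
pose gc (j : int) := if j < - v then 0 else invc c `|(j + v)%R|%N.
have gb : exists b : int, forall j, j < b -> gc j = 0.
  by exists (- v) => j jv; rewrite /gc jv.
exists (Laurent gb); have gv : lsupp (Laurent gb) (- v).
  by move=> j jv /=; rewrite /gc jv.
apply: (@laurent_shiftP _ _ (- v + v)); first exact: lmul_supp.
  by rewrite addNr; exact: lmono_supp.
move=> i; transitivity ((i == 0%N)%:R : k); last first.
  by rewrite addNr add0r /= eqz_nat; case: (i == 0%N).
rewrite -(@invcP c) /=; last by rewrite /c addr0.
rewrite (lconvE (n := i.+1) gv fv); last by lia.
apply: eq_bigr => l _; have := ltn_ord l => li.
rewrite mulrC; congr (_ * _); first by rewrite /c; congr (f _); lia.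
by rewrite /= /gc ifF; [congr (invc c _); lia | lia].
Qed.

Definition linv f : F :=
  if pselect (f != 0) is left f0 then projT1 (cid (laurent_inv_ex f0)) else 0.

Lemma lmulVf f : f != 0 -> linv f * f = 1.
Proof.
by rewrite /linv; case: pselect => // f0 _; case: cid.
Qed.

Lemma linv0 : linv 0 = 0.
Proof. by rewrite /linv; case: pselect => // f0; case/eqP: (f0). Qed.

HB.instance Definition _ := GRing.ComNzRing_isField.Build F lmulVf linv0.

End LaurentRing.


Section Calculus.
Variable k : fieldType.

Lemma lderiv_bdd (f : laurent k) :
  exists a : int, forall j : int, j < a -> (j + 1)%:~R * f (j + 1) = 0.
Proof.
have [a fa] := lsupp_ex f; exists (a - 1) => j ja.
by rewrite fa ?mulr0 //; lia.
Qed.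
(* d/dt *)
Definition lderiv (f : laurent k) : laurent k := Laurent (lderiv_bdd f).

Variables m n : nat.

Definition mxcoef (j : int) (A : 'M[laurent k]_(m, n)) : 'M[k]_(m, n) :=
  map_mx (fun f : laurent k => f j) A.

(* M t^j *)
Definition mxmono (M : 'M[k]_(m, n)) (j : int) : 'M[laurent k]_(m, n) :=
  map_mx (fun c => lmono c j) M.

Definition mx_integral (A : 'M[laurent k]_(m, n)) : Prop :=
  forall j : int, j < 0 -> mxcoef j A = 0.

Definition mx_congr (e : int) (A B : 'M[laurent k]_(m, n)) : Prop :=
  forall j : int, j < e -> mxcoef j A = mxcoef j B.

End Calculus.

Section AlgebraicGroups.
Variables (k : fieldType) (N : nat).

(* The value at g of a polynomial in the N * N matrix entries. *)
Definition mxeval (R : comUnitAlgType k) (p : {mpoly k[N * N]}) (g : 'M[R]_N) : R :=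
  mmap (in_alg R) (fun i => mxvec g 0 i) p.

Definition zero_locus (I : {mpoly k[N * N]} -> Prop) (R : comUnitAlgType k)
    (g : 'M[R]_N) : Prop :=
  g \in unitmx /\ forall p, I p -> mxeval p g = 0.

(* Closed subgroup schemes of GL_N over k, through their functors of points. *)
Record alg_group := AlgGroup {
  equations : {mpoly k[N * N]} -> Prop;
  points : forall R : comUnitAlgType k, 'M[R]_N -> Prop := zero_locus equations;
  points1 : forall R : comUnitAlgType k, points (1%:M : 'M[R]_N);
  pointsM : forall (R : comUnitAlgType k) (g h : 'M[R]_N),
    points g -> points h -> points (g *m h);
  pointsV : forall (R : comUnitAlgType k) (g : 'M[R]_N),
    points g -> points (invmx g)
}.

(* The Lie algebra, as the Zariski tangent space at the identity. *)
Definition Lie (H : alg_group) (X : 'M[k]_N) : Prop :=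
  forall p, equations H p ->
    \sum_(i < N * N) mxeval (R := k^o) (mderiv i p) 1%:M * mxvec X 0 i = 0.

(* Lie H (x) k((t)) *)
Definition LieF (H : alg_group) (A : 'M[laurent k]_N) : Prop :=
  forall j : int, Lie H (mxcoef j A).

Definition unipotent (U : alg_group) : Prop :=
  forall (R : comUnitAlgType k) (u : 'M[R]_N), points U u ->
    iter N (mulmx (u - 1%:M)) 1%:M = 0.

(* G = T |x U *)
Definition semidirect (G T U : alg_group) : Prop :=
  forall R : comUnitAlgType k,
  [/\ forall t : 'M[R]_N, points T t -> points G t,
      forall u : 'M[R]_N, points U u -> points G u,
      forall g u : 'M[R]_N, points G g -> points U u ->
        points U (g *m u *m invmx g) &
      forall g : 'M[R]_N, points G g ->
        exists! tu : 'M[R]_N * 'M[R]_N,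
          [/\ points T tu.1, points U tu.2 & g = tu.1 *m tu.2]].

(* The upper central series of the group functor of U: the preimage in U of
   the center of U / Z_i is cut out by commutators with the points of U over
   all R-algebras. *)
Fixpoint upper_central (U : alg_group) (i : nat) (R : comUnitAlgType k)
    (u : 'M[R]_N) : Prop :=
  if i is i'.+1 then
    points U u /\
    forall (R' : comUnitAlgType k) (f : {lrmorphism R -> R'}) (v : 'M[R']_N),
      points U v ->
      upper_central U i'
        (map_mx f u *m v *m invmx (map_mx f u) *m invmx v)
  else u = 1%:M.

Definition upper_central_full (U : alg_group) (i : nat) : Prop :=
  forall (R : comUnitAlgType k) (u : 'M[R]_N), points U u -> upper_central U i u.

(* Normalized so that commutative groups have class 0. *)
Definition nilpotency_class (U : alg_group) (n : nat) : Prop :=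
  upper_central_full U n.+1 /\
  forall i : nat, (i < n)%N -> ~ upper_central_full U i.+1.

Section Torus.
Variable r : nat.

Definition monomial_at (R : comUnitAlgType k) (a : 'rV[int]_r) (z : 'rV[R]_r) : R :=
  \prod_(i < r) z 0 i ^ a 0 i.

(* A morphism of varieties G_m^r -> Mat_N is a matrix of Laurent polynomials
   sum_(a, M) M z^a, encoded as the list of its terms (a, M). *)
Definition gm_morphism := seq ('rV[int]_r * 'M[k]_N).

Definition gm_eval (phi : gm_morphism) (R : comUnitAlgType k) (z : 'rV[R]_r) :
    'M[R]_N :=
  \sum_(aM <- phi) monomial_at aM.1 z *: map_mx (in_alg R) aM.2.

Definition gm_point (R : comUnitAlgType k) (z : 'rV[R]_r) : Prop :=
  forall i, z 0 i \is a GRing.unit.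

(* phi is an isomorphism of algebraic groups G_m^r -> T; it makes T a split
   torus, with X_*(T) = 'rV[int]_r, where mu is z |-> phi (z^mu_1, ..., z^mu_r),
   and X^*(T) = 'rV[int]_r, where chi is phi z |-> prod_i z_i^chi_i. *)
Definition torus_iso (T : alg_group) (phi : gm_morphism) : Prop :=
  forall R : comUnitAlgType k,
  [/\ forall z : 'rV[R]_r, gm_point z -> points T (gm_eval phi z),
      forall z w : 'rV[R]_r, gm_point z -> gm_point w ->
        gm_eval phi (\row_i (z 0 i * w 0 i)) = gm_eval phi z *m gm_eval phi w,
      forall z w : 'rV[R]_r, gm_point z -> gm_point w ->
        gm_eval phi z = gm_eval phi w -> z = w &
      forall g : 'M[R]_N, points T g ->
        exists2 z : 'rV[R]_r, gm_point z & g = gm_eval phi z].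

(* The differential of phi at 1, that is the isomorphism
   X_*(T) (x) k = k^r -> Lie(T). *)
Definition gm_diff (phi : gm_morphism) (c : 'rV[k]_r) : 'M[k]_N :=
  \sum_(aM <- phi) (\sum_(i < r) (aM.1 0 i)%:~R * c 0 i) *: aM.2.

Definition pairing (mu chi : 'rV[int]_r) : int := \sum_(i < r) mu 0 i * chi 0 i.

(* The weight space for chi of the adjoint action of T on Lie(U). *)
Definition weight_space (phi : gm_morphism) (U : alg_group) (chi : 'rV[int]_r)
    (X : 'M[k]_N) : Prop :=
  Lie U X /\
  forall (R : comUnitAlgType k) (z : 'rV[R]_r), gm_point z ->
    gm_eval phi z *m map_mx (in_alg R) X *m invmx (gm_eval phi z)
    = monomial_at chi z *: map_mx (in_alg R) X.

Definition is_weight (phi : gm_morphism) (U : alg_group) (chi : 'rV[int]_r) : Prop :=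
  exists2 X, X != 0 & weight_space phi U chi X.

Definition weights (phi : gm_morphism) (U : alg_group) l
    (chi : 'I_l -> 'rV[int]_r) : Prop :=
  injective chi /\
  forall c : 'rV[int]_r, is_weight phi U c <-> exists i, c = chi i.

(* mu = b * pi(X) in X_*(T) (x) Q, for X in Lie(T). *)
Definition scaled_proj (phi : gm_morphism) (pi : k -> rat) (b : nat) (X : 'M[k]_N)
    (mu : 'rV[int]_r) : Prop :=
  exists2 c : 'rV[k]_r, X = gm_diff phi c &
    forall i, (mu 0 i)%:~R = b%:R * pi (c 0 i).

(* max ({<mu, chi_i> / b}_i U {0}) *)
Definition max_weight (b : nat) (mu : 'rV[int]_r) l (chi : 'I_l -> 'rV[int]_r) : rat :=
  \big[Order.max/0]_(i < l) ((pairing mu (chi i))%:~R / b%:R).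

End Torus.

Definition Q_linear (pi : k -> rat) : Prop :=
  forall (q : rat) (x y : k), pi (ratr q * x + y) = q * pi x + pi y.

Local Notation F := (laurent k).

Definition gauge (x A : 'M[F]_N) : 'M[F]_N :=
  x *m A *m invmx x + map_mx (@lderiv k) x *m invmx x.

(* H(O), inside H(F) *)
Definition integral_point (H : alg_group) (x : 'M[F]_N) : Prop :=
  [/\ points H x, mx_integral x & mx_integral (invmx x)].

(* sum_(-q <= j <= -1) A_j t^j *)
Definition principal_part (q : nat) (A : 'M[F]_N) : 'M[F]_N :=
  \sum_(1 <= i < q.+1) mxmono (mxcoef (- i%:Z) A) (- i%:Z).

End AlgebraicGroups.

(* Main.v *)
(* Everything happens with explicit exponentials. In characteristic 0 every X in
   Lie(U) (x) F is nilpotent and exp(X) lies in U(F): if s is a sum of n independent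
   square-zero parameters then exp(sX) is a product of points 1 + eps_i X of U, so an
   equation of U evaluated at exp(sX) is a polynomial in s whose Taylor coefficients
   up to order n vanish. Similarly, commutators of points 1 + c X and 1 + eps Y with
   c^2 = eps^2 = 0 are 1 + c eps [X, Y], so nilpotency class n kills all brackets of
   n + 2 elements of Lie(U).

   An element of T(O) first makes the torus components of the two connections equal,
   to a say. If the remaining difference D, in t^e, has its coefficients in the i-th
   term of the upper central series of Lie(U), solve X' - [a, X] = D weight by weight,
   with X in t^(e+1); the only obstruction is a resonance j = <chi, a_(-1)> with j > e,
   which forces j = <mu, chi> / b <= L. As exp(X).A = A + sum_i ad_X^i(E) / (i+1)! with
   E = X' + [X, A], the new difference has its coefficients in the (i-1)-st term and
   lies in t^(e-s), where s = 0 for part (i) and s = |m| - 1 for part (ii). After n + 1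
   steps it vanishes. *)
Require Import Defs.
From HB Require Import structures.
From mathcomp Require Import all_boot all_order all_algebra.
From mathcomp Require Import mpoly zify.
From mathcomp Require Import boolp.
Import Order.TTheory GRing.Theory Num.Theory.
Set Implicit Arguments.
Unset Strict Implicit.
Unset Printing Implicit Defensive.
Local Open Scope ring_scope.

(** * Dual numbers *)

(** The constants of part (ii) count losses of precision. With X in t^(e+1) and A^U in t^m, the
    bracket [X, A^U] lies in t^(e+1+m), so a step costs at most s = |m| - 1. There are n + 1 steps,
    but the last one leaves no difference, so only n losses count: every step takes place at an
    order at least k - ns, and k >= ns + L keeps all of them beyond the resonances. The torus
    components must agree modulo t^(k+|m|-1) because conjugation by x_T = 1 modulo t^(k+|m|) changes
    A^U by an element of t^(k+|m|+m), which lies in t^k.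

    The groups are known only through their points over k-algebras, for arbitrary equations. Facts
    on Lie(U) are obtained by reading off a coefficient in an identity between points 1 + c X with
    c^2 = 0; hence the dual numbers, and their iteration where higher powers are needed. Likewise,
    weight components under T are isolated by evaluating cocharacters at t and reading off a
    coefficient of a Laurent series. *)

Record dual (R : Type) := Dual { dre : R; dep : R }.

HB.instance Definition _ (R : Type) := gen_eqMixin (dual R).
HB.instance Definition _ (R : Type) := gen_choiceMixin (dual R).

Section DualNumbers.
Variables (k : fieldType) (R : comUnitAlgType k).
Implicit Types x y z : dual R.

Definition dual_zero : dual R := Dual 0 0.
Definition dual_opp x : dual R := Dual (- dre x) (- dep x).
Definition dual_add x y : dual R := Dual (dre x + dre y) (dep x + dep y).
Definition dual_scale (c : k) x : dual R := Dual (c *: dre x) (c *: dep x).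
Definition dual_one : dual R := Dual 1 0.
Definition dual_mul x y : dual R :=
  Dual (dre x * dre y) (dre x * dep y + dep x * dre y).

Lemma dual_addA : associative dual_add.
Proof. by move=> [a a'] [b b'] [c c']; congr Dual; apply: addrA. Qed.
Lemma dual_addC : commutative dual_add.
Proof. by move=> [a a'] [b b']; congr Dual; apply: addrC. Qed.
Lemma dual_add0 : left_id dual_zero dual_add.
Proof. by move=> [a a']; congr Dual; apply: add0r. Qed.
Lemma dual_addN : left_inverse dual_zero dual_opp dual_add.
Proof. by move=> [a a']; congr Dual; apply: addNr. Qed.

HB.instance Definition _ := GRing.isZmodule.Build (dual R)
  dual_addA dual_addC dual_add0 dual_addN.

Lemma dual_scaleA c d x : dual_scale c (dual_scale d x) = dual_scale (c * d) x.
Proof. by congr Dual; apply: scalerA. Qed.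
Lemma dual_scale1 : left_id 1 dual_scale.
Proof. by move=> [a a']; congr Dual; apply: scale1r. Qed.
Lemma dual_scaleDr : right_distributive dual_scale +%R.
Proof. by move=> c [a a'] [b b']; congr Dual; apply: scalerDr. Qed.
Lemma dual_scaleDl x : {morph dual_scale^~ x : c d / c + d}.
Proof. by move=> c d; congr Dual; apply: scalerDl. Qed.

HB.instance Definition _ := GRing.Zmodule_isLmodule.Build k (dual R)
  dual_scaleA dual_scale1 dual_scaleDr dual_scaleDl.

Lemma dual_mulA : associative dual_mul.
Proof.
move=> [a a'] [b b'] [c c']; rewrite /dual_mul /=.
by rewrite mulrDr mulrDl !mulrA addrA.
Qed.

Lemma dual_mulC : commutative dual_mul.
Proof.
move=> [a a'] [b b']; rewrite /dual_mul /= addrC.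
by rewrite (mulrC b) (mulrC b') (mulrC b a').
Qed.

Lemma dual_mul1 : left_id dual_one dual_mul.
Proof. by move=> [a a']; rewrite /dual_mul /= !mul1r mul0r addr0. Qed.

Lemma dual_mulDl : left_distributive dual_mul +%R.
Proof.
move=> [a a'] [b b'] [c c']; congr Dual => /=; rewrite !mulrDl //.
by rewrite addrACA.
Qed.

Lemma dual_one_neq0 : dual_one != 0.
Proof. by apply/eqP => /(congr1 (@dre R)) /= /eqP; rewrite oner_eq0. Qed.

HB.instance Definition _ := GRing.Zmodule_isComNzRing.Build (dual R)
  dual_mulA dual_mulC dual_mul1 dual_mulDl dual_one_neq0.

Lemma dual_scaleAl (c : k) x y : c *: (x * y) = (c *: x) * y.
Proof.
case: x y => [a a'] [b b']; congr Dual => /=; first exact: scalerAl.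
by rewrite scalerDr; congr (_ + _); exact: scalerAl.
Qed.

HB.instance Definition _ := GRing.Lmodule_isLalgebra.Build k (dual R) dual_scaleAl.
HB.instance Definition _ := GRing.Lalgebra_isComAlgebra.Build k (dual R).

Definition dual_unit : {pred dual R} := fun x => dre x \is a GRing.unit.
(** (a + a' eps)^-1 = a^-1 - a^-2 a' eps; non-units are sent to themselves, as the unit ring
    interface prescribes. *)
Definition dual_inv x : dual R :=
  if dual_unit x then Dual (dre x)^-1 (- ((dre x)^-1 * (dre x)^-1 * dep x)) else x.

Lemma dual_mulVx : {in dual_unit, left_inverse 1 dual_inv *%R}.
Proof.
move=> [a a']; rewrite unfold_in /dual_inv => Ua; rewrite ifT //.
have {}Ua : a \is a GRing.unit by [].
congr Dual => /=; first exact: mulVr.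
by rewrite mulNr (mulrAC _ a' a) divrK ?subrr.
Qed.

Lemma dual_unitPl x y : y * x = 1 -> dual_unit x.
Proof. by case=> yx _; apply/unitrP; exists (dre y); split=> //; rewrite mulrC. Qed.

Lemma dual_inv_out : {in [predC dual_unit], dual_inv =1 id}.
Proof. by move=> x; rewrite inE unfold_in /dual_inv => Ux; rewrite ifN. Qed.

HB.instance Definition _ := GRing.ComNzRing_hasMulInverse.Build (dual R)
  dual_mulVx dual_unitPl dual_inv_out.
HB.instance Definition _ := GRing.ComUnitAlgebra.on (dual R).

Definition dual_in (a : R) : dual R := Dual a 0.

Fact dual_in_linear : linear dual_in.
Proof. by move=> c a b; congr Dual; rewrite /= scaler0 addr0. Qed.
Fact dual_in_monoid : monoid_morphism dual_in.
Proof.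
split=> // a b; congr Dual => /=; last by rewrite mulr0 mul0r addr0.
Qed.
HB.instance Definition _ := GRing.isLinear.Build k R (dual R) _ dual_in dual_in_linear.
HB.instance Definition _ :=
  GRing.isMonoidMorphism.Build R (dual R) dual_in dual_in_monoid.

Fact dual_dep_linear : linear (@dep R).
Proof. by []. Qed.
HB.instance Definition _ := GRing.isLinear.Build k (dual R) R _ (@dep R) dual_dep_linear.

Fact dual_re_linear : linear (@dre R).
Proof. by []. Qed.
Fact dual_re_monoid : monoid_morphism (@dre R).
Proof. by []. Qed.
HB.instance Definition _ := GRing.isLinear.Build k (dual R) R _ (@dre R) dual_re_linear.
HB.instance Definition _ :=
  GRing.isMonoidMorphism.Build (dual R) R (@dre R) dual_re_monoid.

Definition deps : dual R := Dual 0 1.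

Lemma deps_sq : deps * deps = 0.
Proof. by congr Dual; rewrite /= ?mul0r ?mulr0 ?addr0. Qed.

Lemma deps_mul_in a : deps * dual_in a = Dual 0 a :> dual R.
Proof. by congr Dual => /=; rewrite ?mul0r // mul1r add0r. Qed.

End DualNumbers.

(** * First-order Taylor expansion in a square-zero direction *)

Section Taylor.
Variables (k : fieldType) (n : nat) (R : comUnitAlgType k).
Variables (u : 'I_n -> k) (c : R) (y : 'I_n -> R).
Hypothesis c2 : c * c = 0.

(** Both sides are additive in p and, because c^2 = 0 and by the Leibniz rule, multiplicative in p.
    So it suffices to check constants and variables. *)
Lemma mpoly_taylor (p : {mpoly k[n]}) :
  mmap (in_alg R) (fun i => (u i)%:A + c * y i) p =
  p.@[u]%:A + c * \sum_(i < n) (mderiv i p).@[u] *: y i.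
Proof.
pose Q p := mmap (in_alg R) (fun i => (u i)%:A + c * y i) p =
  p.@[u]%:A + c * \sum_(i < n) (mderiv i p).@[u] *: y i.
have QD p1 p2 : Q p1 -> Q p2 -> Q (p1 + p2).
  rewrite /Q mmapD => -> ->; rewrite mevalD scalerDl addrACA -mulrDr -big_split /=.
  by congr (_ + _ * _); apply: eq_bigr => i _; rewrite mderivD mevalD scalerDl.
have QM p1 p2 : Q p1 -> Q p2 -> Q (p1 * p2).
  rewrite /Q mevalM [mmap _ _ (p1 * p2)]rmorphM /= => -> ->.
  rewrite mulrDl !mulrDr [c * _ * (c * _)]mulrACA c2 mul0r addr0 -addrA.
  rewrite !mulr_algl !mulr_algr scalerA; congr (_ + _).
  rewrite !scalerAr -mulrDr; congr (c * _).
  rewrite !scaler_sumr -big_split /=; apply: eq_bigr => i _.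
  by rewrite mderivM mevalD !mevalM !scalerA scalerDl addrC (mulrC p2.@[u]).
have QC a : Q a%:MP.
  rewrite /Q mmapC mevalC big1 ?mulr0 ?addr0 // => i _.
  by rewrite mderivC meval0 scale0r.
have QX i : Q 'X_i.
  rewrite /Q mmapX mmap1U mevalXU (bigD1 i) //= mderivX mevalZ /=.
  have -> : (U_(i) - U_(i))%MM = 0%MM :> 'X_{1..n} by apply/mnmP => j; rewrite mnmBE subnn mnm0E.
  rewrite mpolyX0 meval1 mnm1E eqxx mulr1 scale1r big1 ?addr0 // => j ji.
  by rewrite mderivX mnm1E eq_sym (negbTE ji) scale0r meval0 scale0r.
rewrite -/(Q p); elim/mpolyind: p => [|a m p _ _ Qp]; first by rewrite -mpolyC0.
apply: (QD) => //; rewrite -mul_mpolyC; apply: (QM) => //.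
rewrite mpolyXE_id; apply: (big_ind Q _ QM).
  by rewrite -mpolyC1.
move=> i _; elim: (m i) => [|d IHd]; first by rewrite expr0 -mpolyC1.
by rewrite exprS; apply: (QM).
Qed.
End Taylor.

Definition lie_bracket (R : pzRingType) n (X Y : 'M[R]_n) : 'M[R]_n :=
  X *m Y - Y *m X.

Section SquareZero.
Variables (R : comUnitRingType) (n : nat) (c : R) (X : 'M[R]_n).
Hypothesis c2 : c * c = 0.

Lemma eps_mulN : (1%:M + c *: X) *m (1%:M - c *: X) = 1%:M.
Proof.
rewrite mulmxDl !mulmxBr !mul1mx mulmx1 -scalemxAl -scalemxAr scalerA c2 scale0r.
by rewrite subr0 subrK.
Qed.

Lemma eps_unitmx : 1%:M + c *: X \in unitmx.
Proof. by have [] := mulmx1_unit eps_mulN. Qed.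

Lemma invmx_eps : invmx (1%:M + c *: X) = 1%:M - c *: X.
Proof. by rewrite -[RHS](mulKmx eps_unitmx) eps_mulN mulmx1. Qed.
End SquareZero.

(** * The Lie algebra through square-zero points *)

Section LiePoints.
Variables (k : fieldType) (N : nat).
Implicit Types (H : alg_group k N) (R : comUnitAlgType k).

(* The coefficients of the differential of p at the identity matrix. *)
Definition lcoefp (i : 'I_(N * N)) (p : {mpoly k[N * N]}) : k :=
  (mderiv i p).@[fun i => mxvec 1%:M 0 i].

Lemma mxeval_base (p : {mpoly k[N * N]}) (g : 'M[k]_N) :
  mxeval (R := k^o) p g = p.@[fun i => mxvec g 0 i].
Proof.
rewrite /mxeval /meval /mmap; apply: eq_bigr => m _; congr (_ * _).
exact: mulr1.
Qed.

(* Lie(H) (x) R *)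
Definition LieR H R (X : 'M[R]_N) : Prop :=
  forall p, equations H p ->
    \sum_(i < N * N) lcoefp i p *: mxvec X 0 i = 0.

Lemma map_mx_alg1 R : map_mx (in_alg R) (1%:M : 'M[k]_N) = 1%:M.
Proof.
by apply/matrixP => i j; rewrite !mxE; case: eqP; rewrite /= ?scale1r ?scale0r.
Qed.

Lemma mxeval_taylor R (c : R) (X : 'M[R]_N) p : c * c = 0 ->
  mxeval p (1%:M + c *: X) =
  p.@[fun i => mxvec 1%:M 0 i]%:A +
  c * \sum_(i < N * N) lcoefp i p *: mxvec X 0 i.
Proof.
move=> c2; rewrite /mxeval -(mpoly_taylor _ _ c2); rewrite /mmap; apply: eq_bigr => m _; congr (_ * _); apply: mmap1_eq => i.
rewrite linearD linearZ /= !mxE; congr (_ + _).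
by rewrite -map_mx_alg1 -map_mxvec mxE.
Qed.

(** In the Taylor expansion of an equation p, the constant term p(1) vanishes because 1 is a point,
    and the linear term is the equation of Lie(H) coming from p. *)
Lemma Lie_point H R (c : R) (X : 'M[R]_N) : c * c = 0 -> LieR H X ->
  points H (1%:M + c *: X).
Proof.
move=> c2 XH; split; first exact: eps_unitmx.
move=> p Hp; rewrite mxeval_taylor // XH // mulr0 addr0.
by have [_ /(_ p Hp)] := points1 H k^o; rewrite mxeval_base => ->; rewrite scale0r.
Qed.

(** A zero divisor c cannot be cancelled in general. It can when c is the parameter of the dual
    numbers over the ring of X, which gives [LieR_dual]. *)
Lemma point_Lie H R (c : R) (X : 'M[R]_N) : c * c = 0 ->
  points H (1%:M + c *: X) -> forall p, equations H p ->
  c * \sum_(i < N * N) lcoefp i p *: mxvec X 0 i = 0.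
Proof.
move=> c2 [_ XH] p Hp; have := XH p Hp; rewrite mxeval_taylor //.
by have [_ /(_ p Hp)] := points1 H k^o; rewrite mxeval_base => ->; rewrite scale0r add0r.
Qed.

Lemma mxeval_map R R' (f : {lrmorphism R -> R'}) (g : 'M[R]_N) p :
  mxeval p (map_mx f g) = f (mxeval p g).
Proof.
rewrite /mxeval /mmap raddf_sum; apply: eq_bigr => m _ /=.
rewrite rmorphM /= -[in RHS]in_algE rmorph_alg; congr (_ * _).
rewrite /mmap1 rmorph_prod; apply: eq_bigr => i _.
by rewrite rmorphXn -map_mxvec mxE.
Qed.

Lemma rmorph_unitmx (R R' : comUnitRingType) (f : {rmorphism R -> R'}) (g : 'M[R]_N) :
  g \in unitmx -> map_mx f g \in unitmx.
Proof. by rewrite !unitmxE det_map_mx; apply: rmorph_unit. Qed.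

Lemma points_map H R R' (f : {lrmorphism R -> R'}) (g : 'M[R]_N) :
  points H g -> points H (map_mx f g).
Proof.
move=> [Ug gH]; split; first exact: rmorph_unitmx.
by move=> p Hp; rewrite mxeval_map gH // raddf0.
Qed.

Lemma LieR_map H R R' (f : {linear R -> R'}) (X : 'M[R]_N) :
  LieR H X -> LieR H (map_mx f X).
Proof.
move=> XH p Hp; rewrite -[RHS](linear0 f) -(XH p Hp) linear_sum.
by apply: eq_bigr => i _; rewrite -map_mxvec mxE linearZ.
Qed.

Lemma LieRD H R (X Y : 'M[R]_N) : LieR H X -> LieR H Y -> LieR H (X + Y).
Proof.
move=> XH YH p Hp; under eq_bigr do rewrite linearD mxE scalerDr.
by rewrite big_split /= XH // YH // addr0.
Qed.

Lemma LieRZ H R (a : R) (X : 'M[R]_N) : LieR H X -> LieR H (a *: X).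
Proof.
move=> XH p Hp; under eq_bigr do rewrite linearZ mxE scalerAr.
by rewrite -mulr_sumr XH // mulr0.
Qed.

Lemma LieR0 H R : LieR H (0 : 'M[R]_N).
Proof. by move=> p Hp; rewrite big1 // => i _; rewrite linear0 mxE scaler0. Qed.

(** The Lie algebra as the kernel of H(R[eps]) -> H(R). This transfers group-theoretic closure
    properties to Lie(H) (x) R. *)
Lemma LieR_dual H R (X : 'M[R]_N) :
  LieR H X <-> points H (1%:M + deps R *: map_mx (@dual_in k R) X).
Proof.
split=> [XH|XH p Hp].
  by apply: Lie_point (deps_sq _) _; apply: LieR_map.
have := point_Lie (deps_sq _) XH Hp.
under eq_bigr do rewrite -map_mxvec mxE -linearZ /=.
by rewrite -linear_sum /= deps_mul_in; case.
Qed.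

Definition normalizes (G U : alg_group k N) := forall R (g u : 'M[R]_N),
  points G g -> points U u -> points U (g *m u *m invmx g).

Lemma map_invmxU (R R' : comUnitRingType) (f : {rmorphism R -> R'}) (g : 'M[R]_N) : g \in unitmx ->
  map_mx f (invmx g) = invmx (map_mx f g).
Proof.
move=> Ug; have Ufg := rmorph_unitmx f Ug.
by rewrite -[LHS](mulKmx Ufg) -map_mxM mulmxV // map_mx1 mulmx1.
Qed.

Lemma LieR_Ad (G U : alg_group k N) R (g X : 'M[R]_N) : normalizes G U ->
  points G g -> LieR U X -> LieR U (g *m X *m invmx g).
Proof.
move=> nGU Gg XU; have Ug : g \in unitmx by case: Gg.
have Ug' := rmorph_unitmx (@dual_in k R) Ug.
have := nGU _ _ _ (points_map (@dual_in k R) Gg)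
  (Lie_point (deps_sq R) (LieR_map (@dual_in k R) XU)).
rewrite mulmxDr mulmxDl -scalemxAr -scalemxAl mulmx1 (mulmxV Ug').
by move=> H; apply/LieR_dual; rewrite !map_mxM (map_invmxU _ Ug).
Qed.

Lemma normalizes_refl U : normalizes U U.
Proof. by move=> R g u Ug Uu; apply: pointsM (pointsM Ug Uu) (pointsV Ug). Qed.

(** Conjugation by the point 1 + eps X takes Y to Y + eps [X, Y], which is again in the Lie algebra
    over R[eps]. Its eps-component is too, since [dep] is linear. *)
Lemma LieR_bracket (U : alg_group k N) R (X Y : 'M[R]_N) :
  LieR U X -> LieR U Y -> LieR U (lie_bracket X Y).
Proof.
move=> XU YU.
have Ug := Lie_point (deps_sq R) (LieR_map (@dual_in k R) XU).
have := LieR_Ad (@normalizes_refl U) Ug (LieR_map (@dual_in k R) YU).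
set X' := map_mx _ X; set Y' := map_mx _ Y.
rewrite invmx_eps ?deps_sq // mulmxDl mul1mx mulmxBr mulmx1.
rewrite -!scalemxAl -!scalemxAr mulmxDl -!scalemxAl !scalerDr !scalerA deps_sq scale0r addr0.
move/(LieR_map (@dep R)); congr (LieR U _).
rewrite -addrA -scalerBr -!map_mxM -map_mxB; apply/matrixP => i j.
by rewrite !mxE linearD deps_mul_in /= add0r.
Qed.

End LiePoints.

(** * Exponentials of nilpotent matrices *)

Section Exponential.
Variables (F : fieldType) (N : nat).
Hypothesis natF : forall m : nat, m.+1%:R != 0 :> F.
Implicit Types X Y : 'M[F]_N.

Lemma mxZl (c : F) X Y : (c *: X) * Y = c *: (X * Y).
Proof. exact: esym (scalemxAl c X Y). Qed.

Lemma mxZr (c : F) X Y : X * (c *: Y) = c *: (X * Y).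
Proof. exact: esym (scalemxAr c X Y). Qed.

Definition ifact (m : nat) : F := (m`!%:R)^-1.

Lemma factF m : m`!%:R != 0 :> F.
Proof. by case: m`! (fact_gt0 m). Qed.

Lemma ifactM m i : (i <= m)%N ->
  ifact m * 'C(m, i)%:R = ifact i * ifact (m - i).
Proof.
move=> im; apply: (mulfI (factF m)); rewrite mulrA mulfV ?factF // mul1r.
rewrite -(bin_fact im) !natrM -!mulrA [X in _ * X](_ : _ = 1) ?mulr1 //.
rewrite [_ * (_ * _)]mulrA mulrACA [_ * ifact i]mulrC mulVf ?factF //.
by rewrite mul1r mulfV ?factF.
Qed.

(** A partial sum with M terms, so that no convergence is involved; it is used when X^M = 0, where
    it is the full exponential. *)
Definition mexp (M : nat) X : 'M[F]_N := \sum_(i < M) ifact i *: X ^+ i.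

Lemma expr_big_nil X (M i : nat) : X ^+ M = 0 -> (M <= i)%N -> X ^+ i = 0.
Proof. by move=> XM Mi; rewrite -(subnKC Mi) exprD XM mul0r. Qed.

Lemma mexp_widen (M M' : nat) X : X ^+ M = 0 -> (M <= M')%N ->
  mexp M' X = mexp M X.
Proof.
move=> XM MM; rewrite /mexp -(subnKC MM) big_split_ord /= [X in _ + X]big1 ?addr0 //.
by move=> i _; rewrite (expr_big_nil XM) ?leq_addr ?scaler0.
Qed.

(** The Cauchy product. Both sequences vanish from M on, so the diagonals below 2M contain all
    nonzero products. *)
Lemma sum_conv (a b : nat -> 'M[F]_N) (M : nat) :
  (forall i, (M <= i)%N -> a i = 0) -> (forall i, (M <= i)%N -> b i = 0) ->
  (\sum_(i < M) a i) * (\sum_(j < M) b j) =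
  \sum_(n < M + M) \sum_(i < n.+1) a i * b (n - i)%N.
Proof.
move=> a0 b0.
transitivity (\sum_(n < M + M) \sum_(i < M + M | (i <= n)%N) a i * b (n - i)%N); last first.
  apply: eq_bigr => n _; rewrite (big_ord_widen (M + M) (fun i => a i * b (n - i)%N)) //.
rewrite (exchange_big_dep xpredT) //= big_split_ord /= [X in _ + X]big1 ?addr0; last first.
  by move=> i _; rewrite -mulr_sumr a0 ?leq_addr ?mul0r.
rewrite mulr_suml; apply: eq_bigr => i _; rewrite mulr_sumr.
rewrite -(big_mkord xpredT (fun j => a i * b j)).
rewrite -(big_mkord (fun n => i <= n)%N (fun n => a i * b (n - i)%N)).
rewrite [RHS](big_cat_nat (n := i)) //=; last by have := ltn_ord i; lia.
rewrite [X in _ = X + _]big_nat_cond [X in _ = X + _]big1 ?add0r; last by move=> j; lia.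
rewrite -{2}[val i]add0n big_addn; have iM := ltnW (ltn_ord i).
rewrite -addnBA // [RHS](big_cat_nat (n := M)) ?leq_addr //=.
rewrite [X in _ = _ + X]big_nat_cond [X in _ = _ + X]big1 ?addr0; last first.
  by move=> j /andP[/andP[Mj _] _]; rewrite addnK b0 ?mulr0.
rewrite big_nat_cond [RHS]big_nat_cond; apply: eq_big => j; first by rewrite leq_addl.
by rewrite addnK.
Qed.

Lemma mexpN (M : nat) X : X ^+ M = 0 -> mexp M X * mexp M (- X) = 1.
Proof.
case: M => [|M] XM.
  by apply/eqP; move: XM; rewrite expr0 => ->; rewrite /mexp !big_ord0 mulr0.
rewrite (sum_conv (a := fun i => ifact i *: X ^+ i)
  (b := fun i => ifact i *: (- X) ^+ i)); last 2 first.
- by move=> i Mi; rewrite (expr_big_nil XM) ?scaler0.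
- by move=> i Mi; rewrite exprNn (expr_big_nil XM) ?mulr0 ?scaler0.
rewrite addSn big_ord_recl big_ord1 subn0 !expr0 big1 ?addr0.
  by rewrite /ifact fact0 invr1 !scale1r mul1r.
move=> n _; set m := lift _ _.
transitivity (ifact m *: (X - X) ^+ m); last by rewrite subrr expr0n /= scaler0.
rewrite addrC exprDn_comm; last by rewrite /GRing.comm mulrN mulNr.
rewrite scaler_sumr; apply: eq_bigr => i _; have im : (i <= m)%N by rewrite -ltnS.
rewrite mxZl mxZr scalerA -ifactM // -scaler_nat scalerA; congr (_ *: _).
by apply: commrX; apply/commr_sym/commrX; rewrite /GRing.comm mulrN mulNr.
Qed.

Lemma mexp_unit (M : nat) X : X ^+ M = 0 -> mexp M X \in unitmx.
Proof. by move=> XM; have [] := mulmx1_unit (mexpN XM). Qed.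

Lemma invmx_mexp (M : nat) X : X ^+ M = 0 -> invmx (mexp M X) = mexp M (- X).
Proof.
move=> XM; have E : mexp M X *m mexp M (- X) = 1%:M by exact: mexpN.
by rewrite -[RHS](mulKmx (mexp_unit XM)) E mulmx1.
Qed.

Local Notation ad := (@lie_bracket F N).

Lemma lie_bracketE X Y : lie_bracket X Y = X * Y - Y * X.
Proof. by []. Qed.

(** Left multiplication by X is the sum of [ad X] and right multiplication by X, and these two
    commute: this is the binomial theorem. *)
Lemma iter_ad_binom X Y n :
  X ^+ n * Y = \sum_(i < n.+1) 'C(n, i)%:R *: (iter i (ad X) Y * X ^+ (n - i)).
Proof.
elim: n => [|n IHn]; first by rewrite big_ord1 expr0 mul1r mulr1 scale1r.
rewrite exprS -mulrA IHn mulr_sumr.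
pose Z i := iter i (ad X) Y.
have XZ (i : 'I_n.+1) : X * ('C(n, i)%:R *: (Z i * X ^+ (n - i))) =
    'C(n, i)%:R *: (Z i.+1 * X ^+ (n - i)) + 'C(n, i)%:R *: (Z i * X ^+ (n.+1 - i)).
  rewrite mxZr -scalerDr; congr (_ *: _).
  by rewrite mulrA subSn -1?ltnS // exprS mulrA -mulrDl /Z /= lie_bracketE subrK.
rewrite (eq_bigr _ (fun i _ => XZ i)) big_split /= big_ord_recr /=.
rewrite [X in _ + X]big_ord_recl [RHS]big_ord_recl big_ord_recr /=.
rewrite [LHS]addrC -!addrA; congr (_ + _); first by rewrite !bin0 !subn0.
rewrite addrA; congr (_ + _); last by rewrite !binn !subnn.
rewrite -big_split /=; apply: eq_bigr => i _.
by rewrite /bump /= add1n subSS binS natrD scalerDl.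
Qed.

(** The product expands into terms X^i Y X^j with i + j = a + b + n >= 2M, so that i >= M or j >= M.
    The outer powers of X are there for the induction. *)
Lemma ad_nil (M : nat) X Y n a b : X ^+ M = 0 -> (M + M <= a + b + n)%N ->
  X ^+ a * iter n (ad X) Y * X ^+ b = 0.
Proof.
move=> XM; elim: n a b => [|n IHn] a b Mab.
  have [Ma|Ma] := leqP M a; first by rewrite (expr_big_nil XM Ma) !mul0r.
  by rewrite (expr_big_nil (i := b) XM) ?mulr0 //; lia.
rewrite /= lie_bracketE mulrBr mulrBl !mulrA -exprSr -(mulrA _ X) -exprS.
by rewrite !IHn ?subrr //; lia.
Qed.

(** Ad(exp X) = exp(ad X), with exp X moved to the right to avoid the inverse. It is [iter_ad_binom]
    divided by n! and summed over n. *)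
Lemma mexp_conj (M : nat) X Y : X ^+ M = 0 ->
  mexp M X * Y = (\sum_(i < M + M) ifact i *: iter i (ad X) Y) * mexp M X.
Proof.
move=> XM.
have ad0 i : (M + M <= i)%N -> iter i (ad X) Y = 0.
  move=> Mi; have := ad_nil (a := 0) (b := 0) Y XM (leq_trans Mi (leq_addl _ i)).
  by rewrite expr0 mul1r mulr1.
rewrite -{2}(mexp_widen XM (leq_addr M M)).
rewrite (sum_conv (a := fun i => ifact i *: iter i (ad X) Y)
  (b := fun i => ifact i *: X ^+ i)); last 2 first.
- by move=> i Mi; rewrite ad0 ?scaler0.
- by move=> i Mi; rewrite (expr_big_nil XM) ?scaler0 //; lia.
rewrite -/(mexp M X) -(mexp_widen XM (leq_addr (M + M + M) M)) addnA.
rewrite /mexp mulr_suml !addnA; apply: eq_bigr => n _.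
rewrite mxZl iter_ad_binom scaler_sumr; apply: eq_bigr => i _.
by rewrite mxZl mxZr !scalerA ifactM // -ltnS.
Qed.

End Exponential.

(** * The Lie algebra of a nilpotent group *)

Section LieCentral.
Variables (k : fieldType) (N : nat).
Implicit Types (U : alg_group k N) (R : comUnitAlgType k).

Lemma LieE U (X : 'M[k]_N) : Lie U X <-> LieR (R := k^o) U X.
Proof.
have E p : \sum_(i < N * N) mxeval (R := k^o) (mderiv i p) 1%:M * mxvec X 0 i =
    \sum_(i < N * N) lcoefp i p *: (mxvec X 0 i : k^o).
  by apply: eq_bigr => i _; rewrite mxeval_base.
by split=> XU p Up; have := XU p Up; rewrite E.
Qed.

Lemma Lie_LieR U R (X : 'M[k]_N) : Lie U X -> LieR U (map_mx (in_alg R) X).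
Proof.
move=> /LieE XU p Up; rewrite -[RHS](rmorph0 (in_alg R)) -(XU p Up) raddf_sum /=.
by apply: eq_bigr => i _; rewrite -map_mxvec mxE /= scalerA.
Qed.

Lemma Lie_bracket U (X Y : 'M[k]_N) : Lie U X -> Lie U Y -> Lie U (lie_bracket X Y).
Proof. by rewrite !LieE; apply: LieR_bracket. Qed.

Fixpoint lie_central U (i : nat) (X : 'M[k]_N) : Prop :=
  if i is i'.+1 then
    Lie U X /\ forall Y, Lie U Y -> lie_central U i' (lie_bracket X Y)
  else X = 0.

(** Once the inverses are multiplied out, the two sides differ only by terms containing a^2 or
    e^2. *)
Lemma eps_commutator R (a e : R) (X Y : 'M[R]_N) : a * a = 0 -> e * e = 0 ->
  (1%:M + a *: X) *m (1%:M + e *: Y) *m invmx (1%:M + a *: X) *m invmx (1%:M + e *: Y) =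
  1%:M + (a * e) *: lie_bracket X Y.
Proof.
move=> a2 e2.
have E : (1%:M + a *: X) *m (1%:M + e *: Y) =
    (1%:M + (a * e) *: lie_bracket X Y) *m (1%:M + e *: Y) *m (1%:M + a *: X).
  rewrite !mulmxDl !mulmxDr !mulmx1 !mul1mx -!scalemxAl -!scalemxAr !mulmxDl.
  rewrite -!scalemxAl !scalerA.
  have -> : a * e * e = 0 by rewrite -mulrA e2 mulr0.
  rewrite !scale0r !addr0 mul1mx scalerDr !scalerA mulrA a2 mul0r scale0r addr0.
  by rewrite /lie_bracket scalerBr -!addrA; do 3!congr (_ + _); rewrite addrCA subrr addr0.
by rewrite E (mulmxK (eps_unitmx _ a2)) (mulmxK (eps_unitmx _ e2)).
Qed.

Lemma map_in_alg_lrmorph R R' (f : {lrmorphism R -> R'}) (X : 'M[k]_N) :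
  map_mx f (map_mx (in_alg R) X) = map_mx (in_alg R') X.
Proof. by apply/matrixP => i j; rewrite !mxE rmorph_alg. Qed.

(** Each commutator uses a fresh parameter eps, adjoined by passing to dual numbers, and replaces c
    by c eps, which is again nonzero of square zero. This is where points v over extensions of R
    enter. At the bottom c X = 0 forces X = 0, because X has entries in the field k. *)
Lemma upper_central_Lie U i R (c : R) (X : 'M[k]_N) : c * c = 0 -> c != 0 ->
  Lie U X -> upper_central U i (1%:M + c *: map_mx (in_alg R) X) ->
  lie_central U i X.
Proof.
elim: i R c X => [|i IHi] R c X c2 c0 XU /=.
  move=> /eqP; rewrite -subr_eq0 addrC addKr => /eqP/matrixP cX.
  apply/matrixP => a b; have := cX a b; rewrite !mxE mulr_algr => /eqP.
  by rewrite scaler_eq0 (negbTE c0) orbF => /eqP.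
move=> [_ Uc]; split=> // Y YU.
have := Uc (dual R) (@dual_in k R) _ (Lie_point (deps_sq R) (Lie_LieR (dual R) YU)).
have -> : map_mx (@dual_in k R) (1%:M + c *: map_mx (in_alg R) X) =
    1%:M + dual_in c *: map_mx (in_alg (dual R)) X.
  by rewrite map_mxD map_mxZ map_in_alg_lrmorph map_mx1.
rewrite eps_commutator ?deps_sq //; last by rewrite -rmorphM c2 rmorph0.
have -> : lie_bracket (map_mx (in_alg (dual R)) X) (map_mx (in_alg (dual R)) Y) =
    map_mx (in_alg (dual R)) (lie_bracket X Y).
  by rewrite /lie_bracket map_mxB !map_mxM.
have E : dual_in c * deps R = Dual 0 c by rewrite mulrC deps_mul_in.
apply: IHi; last exact: Lie_bracket.
  by rewrite E; congr Dual; rewrite /= ?mul0r ?mulr0 ?addr0.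
by rewrite E; apply: contra c0 => /eqP/(congr1 (@dep R))/= ->.
Qed.

Lemma nilpotent_Lie U n (X : 'M[k]_N) : upper_central_full U n -> Lie U X ->
  lie_central U n X.
Proof.
move=> Un XU; apply: (upper_central_Lie (R := dual k^o) (deps_sq _)) => //.
  by apply/eqP => /(congr1 (@dep k)) /eqP; rewrite oner_eq0.
by apply: Un; apply: Lie_point (deps_sq _) _; apply: Lie_LieR.
Qed.

End LieCentral.

(** * Exponentials of elements of the Lie algebra *)

Section LieExp.
Variables (k : fieldType) (N : nat).
Hypothesis natk : forall m : nat, m.+1%:R != 0 :> k.

Lemma nat_unit (R : comUnitAlgType k) (m : nat) : m.+1%:R \is a @GRing.unit R.
Proof. by rewrite -[_%:R](rmorph_nat (in_alg R)) rmorph_unit // unitfE. Qed.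

Lemma fact_unit (R : comUnitAlgType k) (m : nat) : m`!%:R \is a @GRing.unit R.
Proof. by case: m`! (fact_gt0 m) => // f _; apply: nat_unit. Qed.

Definition divpow (R : comUnitAlgType k) (j : nat) (s : R) : R := s ^+ j / j`!%:R.

Lemma divpowD (R : comUnitAlgType k) (s e : R) j : e * e = 0 ->
  divpow j.+1 (s + e) = divpow j.+1 s + divpow j s * e.
Proof.
move=> e2.
have E i : (s + e) ^+ i.+1 = s ^+ i.+1 + i.+1%:R * s ^+ i * e.
  elim: i => [|i IHi]; first by rewrite expr0 !expr1 !mul1r.
  rewrite exprSr IHi mulrDl !mulrDr -exprSr -(mulrA _ e e) e2 mulr0 addr0.
  rewrite -addrA; congr (_ + _).
  by rewrite -[i.+2%:R]natr1 !mulrDl mul1r addrC mulrAC -(mulrA _ _ s) -exprSr.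
rewrite /divpow E mulrDl; congr (_ + _).
rewrite factS natrM invrM ?nat_unit ?fact_unit //.
have := mulrV (nat_unit R j); move: _^-1 (s ^+ j) => u sj u1.
by rewrite mulrA mulrC !mulrA (mulrC u) u1 mul1r mulrAC.
Qed.

(** Here it is s that will be nilpotent, not X. The index n is the last exponent, so there are n + 1
    terms, against M terms in [mexp M]. *)
Definition mexpR (R : comUnitAlgType k) n (s : R) (X : 'M[R]_N) : 'M[R]_N :=
  \sum_(j < n.+1) divpow j s *: X ^+ j.

Lemma map_mx_exp (R R' : nzRingType) (f : {rmorphism R -> R'}) (X : 'M[R]_N) j :
  map_mx f (X ^+ j) = (map_mx f X) ^+ j.
Proof.
elim: j => [|j IHj]; first by rewrite !expr0; apply: map_mx1.
by rewrite !exprS -IHj; apply: map_mxM.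
Qed.

Lemma map_mexpR (R R' : comUnitAlgType k) (f : {rmorphism R -> R'}) n s (X : 'M[R]_N) :
  map_mx f (mexpR n s X) = mexpR n (f s) (map_mx f X).
Proof.
rewrite /mexpR raddf_sum; apply: eq_bigr => j _.
by rewrite /= map_mxZ map_mx_exp /divpow rmorphM rmorphV ?fact_unit // rmorph_nat rmorphXn.
Qed.

(** exp((s + e) X) = exp(s X) (1 + e X), since the divided powers satisfy (s + e)^[j+1] = s^[j+1] +
    s^[j] e. The order of truncation grows by one together with the nilpotency order of the
    parameter. *)
Lemma mexpR_add (R : comUnitAlgType k) n (s e : R) (X : 'M[R]_N) :
  s ^+ n.+1 = 0 -> e * e = 0 ->
  mexpR n.+1 (s + e) X = mexpR n s X *m (1%:M + e *: X).
Proof.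
move=> sn e2; rewrite mulmxDr mulmx1 /mexpR mulmx_suml.
rewrite [X in _ = X + _](_ : _ = \sum_(j < n.+2) divpow j s *: X ^+ j); last first.
  by rewrite [RHS]big_ord_recr /= /(divpow n.+1 s) sn mul0r scale0r addr0.
rewrite big_ord_recl [in RHS]big_ord_recl -addrA; congr (_ + _).
rewrite -big_split; apply: eq_bigr => j _ /=.
rewrite divpowD // scalerDl; congr (_ + _).
by rewrite -scalemxAl -scalemxAr scalerA exprSr.
Qed.

Lemma horner_dual (B R : comUnitAlgType k) (f : {rmorphism B -> R}) (s : R) (p : {poly B}) :
  (map_poly (@dual_in k R \o f) p).[dual_in s + deps R] =
  Dual (map_poly f p).[s] (map_poly f p^`()).[s].
Proof.
elim/poly_ind: p => [|p c IHp]; first by rewrite deriv0 !rmorph0 !horner0.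
rewrite !rmorphD !rmorphM /= !map_polyX !map_polyC /= !hornerE IHp.
rewrite derivD derivC addr0 derivM derivX mulr1 rmorphD rmorphM /= map_polyX !hornerE.
congr Dual => /=; first by rewrite addr0.
by rewrite add0r !addr0 mulr1 addrC.
Qed.

(** R is an n-fold tower of dual numbers over B and s the sum of its n parameters. The last clause
    says that 1, s, ..., s^n are independent over B: p(s + eps) = 0 means p(s) = 0 and p'(s) = 0,
    and the coefficients of p' up to order n determine those of p of order 1 to n + 1 after division
    by j + 1. *)
Lemma truncated_exp_point (B : comUnitAlgType k) n :
  exists (R : comUnitAlgType k) (f : {lrmorphism B -> R}) (s : R),
  [/\ s ^+ n.+1 = 0,
      forall (H : alg_group k N) (X : 'M[B]_N), LieR H X ->
        points H (mexpR n s (map_mx f X)) &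
      forall p : {poly B}, (map_poly f p).[s] = 0 ->
        forall j, (j <= n)%N -> p`_j = 0].
Proof.
elim: n => [|n [R [f [s [s0 sH sp]]]]].
  exists B, idfun, 0; split=> [|H X _|p p0 [|//] _].
  - by rewrite expr1.
  - rewrite /mexpR big_ord1 /divpow !expr0 mul1r fact0 invr1 scale1r.
    exact: points1.
  - by rewrite -horner_coef0 -[RHS]p0 map_poly_id.
exists (dual R), (@dual_in k R \o f), (dual_in s + deps R); split=> [|H X XH|p].
- have s1 : dual_in s ^+ n.+1 = 0 by rewrite -rmorphXn s0 rmorph0.
  have := divpowD (dual_in s) n.+1 (deps_sq R).
  rewrite /divpow [dual_in s ^+ _]exprS s1 mulr0 !mul0r addr0.
  by move/(congr1 ( *%R^~ (n.+2)`!%:R)); rewrite divrK ?fact_unit // mul0r.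
- rewrite mexpR_add ?deps_sq //; last by rewrite -rmorphXn s0 rmorph0.
  rewrite (map_mx_comp f (@dual_in k R)) -map_mexpR.
  apply: pointsM; first exact: points_map (sH _ _ XH).
  by apply: Lie_point (deps_sq R) _; do 2!apply: LieR_map.
- rewrite horner_dual => -[ps dps] [|j] jn; first exact: sp.
  have := sp _ dps j jn; rewrite coef_deriv -mulr_natr => /(congr1 ( *%R^~ (j.+1%:R)^-1)).
  by rewrite mulrK ?nat_unit // mul0r.
Qed.

End LieExp.

Section UnipotentExp.
Variables (k : fieldType) (N : nat).
Hypothesis natk : forall m : nat, m.+1%:R != 0 :> k.
Variables (U : alg_group k N) (U_unip : unipotent U).

Lemma iter_mulmx (R : pzRingType) n (Y : 'M[R]_n) j : iter j (mulmx Y) 1%:M = Y ^+ j.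
Proof. by elim: j => [|j IHj] //=; rewrite IHj exprS. Qed.

Lemma mexpR_sub1 (R : comUnitAlgType k) n s (X : 'M[R]_N) : (0 < n)%N ->
  exists Y, mexpR n s X - 1%:M = s *: X + s ^+ 2 *: Y.
Proof.
case: n => // n _; rewrite /mexpR !big_ord_recl /divpow /= expr0 fact0 divr1 scale1r.
rewrite addrAC subrr add0r /bump /= !add1n !expr1 factS fact0 muln1 divr1.
exists (\sum_(j < n) (s ^+ j / j.+2`!%:R) *: X ^+ j.+2); congr (_ + _).
rewrite scaler_sumr; apply: eq_bigr => j _;  rewrite scalerA mulrA -exprD.
by rewrite /bump /= !add1n.
Qed.

(** exp(s X) - 1 = s X + s^2 Y has N-th power s^N X^N, up to a multiple of s^(N+1) = 0. This power
    vanishes because exp(s X) is a point of U, and s^N cancels by the last clause of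
    [truncated_exp_point]. *)
Lemma unipotent_nil (B : comUnitAlgType k) (X : 'M[B]_N) : LieR U X -> X ^+ N = 0.
Proof.
move=> XU; have [R [f [s [s0 sH sp]]]] := truncated_exp_point N natk B N.
have := U_unip (sH _ _ XU); rewrite iter_mulmx; set X' := map_mx f X => XN.
have [Y gY] : exists Y, mexpR N s X' - 1%:M = s *: X' + s ^+ 2 *: Y.
  have [N0|Npos] := posnP N; last exact: mexpR_sub1.
  by exists 0; apply/matrixP => i; have := ltn_ord i; rewrite [X in (_ < X)%N]N0.
have gN j : exists Z, (mexpR N s X' - 1%:M) ^+ j = s ^+ j *: X' ^+ j + s ^+ j.+1 *: Z.
  elim: j => [|j [Z gZ]]; first by exists 0; rewrite !expr0 scale1r scaler0 addr0.
  exists (X' ^+ j *m Y + Z *m X' + s *: (Z *m Y)).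
  rewrite exprSr gZ gY [LHS]mulmxDl !mulmxDr -!scalemxAl -!scalemxAr !scalerA.
  rewrite -!exprD -!exprSr addn2 !scalerDr !scalerA -exprSr -!addrA.
  by rewrite addn2 [X' ^+ j.+1]exprSr.
have XsN : s ^+ N *: X' ^+ N = 0.
  by have [Z] := gN N; rewrite XN s0 scale0r addr0 => <-.
apply/matrixP => a b; rewrite mxE.
have := sp ((X ^+ N) a b *: 'X^N) _ N (leqnn N); rewrite coefZ coefXn eqxx mulr1; apply.
rewrite map_polyZ /= map_polyXn hornerZ hornerXn.
by have /matrixP/(_ a b) := XsN; rewrite -map_mx_exp !mxE mulrC.
Qed.

Lemma mmap_rmorph (S S' : nzRingType) (g : {rmorphism S -> S'}) n (h : k -> S) (v : 'I_n -> S) p :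
  g (mmap h v p) = mmap (g \o h) (g \o v) p.
Proof.
rewrite /mmap raddf_sum; apply: eq_bigr => m _ /=; rewrite rmorphM /=; congr (_ * _).
by rewrite /mmap1 rmorph_prod; apply: eq_bigr => i _; rewrite rmorphXn.
Qed.

Local Notation F := (laurent k).

Lemma natF m : m.+1%:R != 0 :> F.
Proof. by have := nat_unit natk F m; rewrite unitfE. Qed.

Lemma pointsP (H : alg_group k N) (X : 'M[F]_N) : X \in unitmx ->
  (forall p, equations H p -> mxeval p X = 0) -> points H X.
Proof. by move=> UX XH; split. Qed.

Lemma exp_point (X : 'M[F]_N) : LieR U X -> points U (mexp N X).
Proof.
move=> XU; have XN := unipotent_nil XU.
have exp_unit := mexp_unit natF XN; apply: pointsP; first exact: exp_unit.
move=> p Up.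
(* [G] is exp(zX) as a matrix over F[z], and [P] is the equation p evaluated at it. The claim is P =
   0; then z = 1 gives the result. *)
pose G : 'M[{poly F}]_N := \matrix_(i, j) \poly_(l < N) (ifact F l * (X ^+ l) i j).
pose P : {poly F} := mmap (polyC \o in_alg F) (fun i => mxvec G 0 i) p.
have PE (R : comUnitAlgType k) (f : {lrmorphism F -> R}) (s : R) :
    (map_poly f P).[s] = mxeval p (\sum_(l < N) divpow l s *: map_mx f X ^+ l).
  rewrite /P -[_.[s]]/((horner_eval s \o map_poly f) _) mmap_rmorph /mxeval /mmap.
  apply: eq_bigr => m _; congr (_ * _).
    by rewrite /= /horner_eval map_polyC hornerC /= rmorph_alg.
  apply: mmap1_eq => i /=; case/mxvec_indexP: i => i l; rewrite !mxvecE !mxE.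
  rewrite /horner_eval summxE (@horner_coef_wide _ N); last first.
    by apply: leq_trans (size_poly _ _) _; apply: size_poly.
  apply: eq_bigr => j _; rewrite coef_map coef_poly ltn_ord /=.
  rewrite mxE -map_mx_exp mxE rmorphM /divpow mulrC mulrA; congr (_ * _ * _).
  by rewrite /ifact rmorphV ?fact_unit // rmorph_nat.
suff P0 : P = 0.
  have := PE F idfun 1; rewrite P0 rmorph0 horner0 => ->; congr (mxeval p _).
  apply: eq_bigr => l _; rewrite /divpow expr1n mul1r; congr (_ *: _).
  by rewrite map_mx_id.
apply/polyP => j; rewrite coef0.
(* Order N + j is enough twice: no term of exp(sX) is cut off, as X^N = 0, and the coefficient of
   z^j is detected. *)
have [R [f [s [s0 sH sp]]]] := truncated_exp_point N natk F (N + j).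
apply: (sp) (leq_addl _ _); rewrite PE; have [_ /(_ p Up)] := sH _ _ XU.
rewrite /mexpR -addnS big_split_ord /= [X in _ + X]big1 ?addr0 // => i _.
by rewrite -map_mx_exp exprD XN mul0r map_mx0 scaler0.
Qed.
End UnipotentExp.

(** * Laurent series and matrices of Laurent series *)

Section LaurentCalculus.
Variable k : fieldType.
Local Notation F := (laurent k).
Implicit Types (f g : F) (i j : int).

Lemma lcoef_sum I (r : seq I) (P : pred I) (G : I -> F) j :
  (\sum_(i <- r | P i) G i) j = \sum_(i <- r | P i) G i j.
Proof. by apply: (big_morph (fun f : F => f j)). Qed.

Lemma lalgE (c : k) : c%:A = lmono c 0 :> F.
Proof.
by apply: laurentP => j /=; case: eqP; rewrite ?mulr1 ?mulr0.
Qed.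

Lemma lmonoM (c d : k) i j : lmono c i * lmono d j = lmono (c * d) (i + j).
Proof.
apply: laurentP => l; rewrite [LHS]lmono_mulE /=.
by rewrite subr_eq addrC; case: ifP; rewrite ?mulr0.
Qed.

Lemma lderivD f g : lderiv (f + g) = lderiv f + lderiv g.
Proof. by apply: laurentP => j /=; rewrite mulrDr. Qed.

Lemma lderiv0 : lderiv 0 = 0 :> F.
Proof. by apply: laurentP => j /=; rewrite mulr0. Qed.

Lemma lderiv_sum I (r : seq I) (P : pred I) (G : I -> F) :
  lderiv (\sum_(i <- r | P i) G i) = \sum_(i <- r | P i) lderiv (G i).
Proof. by apply: (big_morph (@lderiv k)); [exact: lderivD | exact: lderiv0]. Qed.

Lemma lderivM f g : lderiv (f * g) = lderiv f * g + f * lderiv g.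
Proof.
have [[a fa] [b gb]] := (lsupp_ex f, lsupp_ex g).
have dfa : lsupp (lderiv f) (a - 1) by move=> j ja /=; rewrite fa ?mulr0 //; lia.
have dgb : lsupp (lderiv g) (b - 1) by move=> j jb /=; rewrite gb ?mulr0 //; lia.
apply: laurentP => j; pose n := `|(j + 1 - a - b)%R|%N.+1.
rewrite [LHS]/= [RHS]/=.
rewrite (lconvE (n := n) fa gb) ?(lconvE (n := n) dfa gb) ?(lconvE (n := n) fa dgb); try by rewrite /n; lia.
rewrite mulr_sumr -big_split /=; apply: eq_bigr => i _.
have -> : a - 1 + i%:Z + 1 = a + i%:Z by lia.
have -> : j - (a - 1 + i%:Z) = j + 1 - (a + i%:Z) by lia.
have -> : j - (a + i%:Z) + 1 = j + 1 - (a + i%:Z) by lia.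
(* The factor j + 1 is the sum of the degrees of the two coefficients that are multiplied; this is
   the Leibniz rule term by term. *)
have {1}-> : j + 1 = (a + i%:Z) + (j + 1 - (a + i%:Z)) by lia.
by rewrite rmorphD /= mulrDl mulrA [in RHS]mulrCA.
Qed.

Lemma lderiv_alg (c : k) : lderiv (c%:A : F) = 0.
Proof.
apply: laurentP => j; rewrite lalgE /=; case: eqP => [->|_]; rewrite ?mulr0 //.
by rewrite mul0r.
Qed.

Lemma lderiv_nat m : lderiv (m%:R : F) = 0.
Proof. by rewrite -(rmorph_nat (in_alg F)) lderiv_alg. Qed.

Lemma lderivV f : lderiv f = 0 -> lderiv f^-1 = 0.
Proof.
have [-> _|f0 df] := eqVneq f 0; first by rewrite invr0 lderiv0.
have := lderivM f f^-1; rewrite mulfV // df mul0r add0r -[1](rmorph_nat (in_alg F) 1).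
by rewrite lderiv_alg => /esym/eqP; rewrite mulf_eq0 (negbTE f0) => /eqP.
Qed.

End LaurentCalculus.

Section LaurentMatrices.
Variable k : fieldType.
Local Notation F := (laurent k).

Local Notation dmx := (map_mx (@lderiv k)).

Definition mxsupp m n (a : int) (A : 'M[F]_(m, n)) : Prop :=
  forall j : int, j < a -> mxcoef j A = 0.

Section Rect.
Variables m n : nat.
Implicit Types A B : 'M[F]_(m, n).

Lemma mxP A B : (forall j, mxcoef j A = mxcoef j B) -> A = B.
Proof.
move=> AB; apply/matrixP => i l; apply: laurentP => j.
by have /matrixP/(_ i l) := AB j; rewrite !mxE.
Qed.

Lemma mxcoefD j A B : mxcoef j (A + B) = mxcoef j A + mxcoef j B.
Proof. by apply/matrixP => i l; rewrite !mxE. Qed.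

Lemma mxcoefN j A : mxcoef j (- A) = - mxcoef j A.
Proof. by apply/matrixP => i l; rewrite !mxE. Qed.

Lemma mxcoefB j A B : mxcoef j (A - B) = mxcoef j A - mxcoef j B.
Proof. by rewrite mxcoefD mxcoefN. Qed.

Lemma mxcoef0 j : mxcoef j (0 : 'M[F]_(m, n)) = 0.
Proof. by apply/matrixP => i l; rewrite !mxE. Qed.

Lemma mxcoef_sum I (r : seq I) (P : pred I) (G : I -> 'M[F]_(m, n)) j :
  mxcoef j (\sum_(i <- r | P i) G i) = \sum_(i <- r | P i) mxcoef j (G i).
Proof. by apply: (big_morph (mxcoef j)); [exact: mxcoefD | exact: mxcoef0]. Qed.

Lemma mxcoef_mono (M : 'M[k]_(m, n)) i j :
  mxcoef j (mxmono M i) = if j == i then M else 0.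
Proof. by apply/matrixP => a b; rewrite !mxE /=; case: eqP; rewrite ?mxE. Qed.

Lemma mxcoef_lmonoZ (M : 'M[k]_(m, n)) i j :
  mxcoef j (lmono 1 i *: map_mx (in_alg F) M) = if j == i then M else 0.
Proof.
apply/matrixP => a b; rewrite !mxE [GRing.in_alg F _]lalgE [_ * _]lmonoM mul1r addr0 /=.
by case: eqP; rewrite ?mxE.
Qed.

Lemma mxcoef_deriv j A : mxcoef j (dmx A) = (j + 1)%:~R *: mxcoef (j + 1) A.
Proof. by apply/matrixP => i l; rewrite !mxE. Qed.

Lemma mxsupp_ex A : exists a, mxsupp a A.
Proof.
suff [a aP] : exists a, forall i l, lsupp (A i l) a.
  by exists a => j ja; apply/matrixP => i l; rewrite !mxE aP.
pose s := [seq (i, l) | i <- enum 'I_m, l <- enum 'I_n].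
suff [a aP] : exists a, forall x, x \in s -> lsupp (A x.1 x.2) a.
  by exists a => i l; apply: (aP (i, l)); rewrite allpairs_f ?mem_enum.
elim: s => [|x s [a aP]]; first by exists 0.
have [b xb] := lsupp_ex (A x.1 x.2); exists (Num.min a b) => y.
rewrite inE => /predU1P[->|/aP ya]; first by apply: lsuppW xb; rewrite ge_min lexx orbT.
by apply: lsuppW ya; rewrite ge_min lexx.
Qed.

Lemma mxsuppE a A i l : mxsupp a A -> lsupp (A i l) a.
Proof. by move=> Aa j ja; have /matrixP/(_ i l) := Aa j ja; rewrite !mxE. Qed.

Lemma mxsuppW a b A : b <= a -> mxsupp a A -> mxsupp b A.
Proof. by move=> ba Aa j jb; apply: Aa; apply: lt_le_trans jb ba. Qed.

Lemma mxsuppD a A B : mxsupp a A -> mxsupp a B -> mxsupp a (A + B).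
Proof. by move=> Aa Ba j ja; rewrite mxcoefD Aa // Ba // addr0. Qed.

Lemma mxsuppN a A : mxsupp a A -> mxsupp a (- A).
Proof. by move=> Aa j ja; rewrite mxcoefN Aa // oppr0. Qed.

Lemma mxsuppB a A B : mxsupp a A -> mxsupp a B -> mxsupp a (A - B).
Proof. by move=> Aa Ba; apply: mxsuppD => //; apply: mxsuppN. Qed.

Lemma mxsupp0 a : mxsupp a (0 : 'M[F]_(m, n)).
Proof. by move=> j _; rewrite mxcoef0. Qed.

Lemma mxsupp_sum a I (r : seq I) (P : pred I) (G : I -> 'M[F]_(m, n)) :
  (forall i, P i -> mxsupp a (G i)) -> mxsupp a (\sum_(i <- r | P i) G i).
Proof. by move=> Ga j ja; rewrite mxcoef_sum big1 // => i /Ga->. Qed.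

Lemma mxcoefZ (f : F) A a b (s : nat) j : lsupp f a -> mxsupp b A ->
  j < a + b + s%:Z ->
  mxcoef j (f *: A) = \sum_(i < s) f (a + i%:Z) *: mxcoef (j - (a + i%:Z)) A.
Proof.
move=> fa Ab js; apply/matrixP => x y; rewrite summxE !mxE.
rewrite [LHS](lconvE fa (mxsuppE x y Ab) js).
by apply: eq_bigr => i _; rewrite !mxE.
Qed.

Lemma mxsuppZ (f : F) A a b : lsupp f a -> mxsupp b A -> mxsupp (a + b) (f *: A).
Proof.
by move=> fa Ab j ja; rewrite (mxcoefZ (s := 0) fa Ab) ?big_ord0 // addr0.
Qed.

Lemma dmxD A B : dmx (A + B) = dmx A + dmx B.
Proof. by apply/matrixP => i l; rewrite !mxE lderivD. Qed.

Lemma dmx0 : dmx (0 : 'M[F]_(m, n)) = 0.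
Proof. by apply/matrixP => i l; rewrite !mxE lderiv0. Qed.

Lemma dmx_sum I (r : seq I) (P : pred I) (G : I -> 'M[F]_(m, n)) :
  dmx (\sum_(i <- r | P i) G i) = \sum_(i <- r | P i) dmx (G i).
Proof. by apply: (big_morph (fun A => dmx A)); [exact: dmxD | exact: dmx0]. Qed.

Lemma dmxZ (f : F) A : dmx (f *: A) = lderiv f *: A + f *: dmx A.
Proof. by apply/matrixP => i l; rewrite !mxE lderivM. Qed.

Lemma dmx_alg (M : 'M[k]_(m, n)) : dmx (map_mx (in_alg F) M) = 0.
Proof. by apply/matrixP => i l; rewrite !mxE lderiv_alg. Qed.

End Rect.

Lemma mxcoefM m n p (A : 'M[F]_(m, n)) (B : 'M[F]_(n, p)) a b (s : nat) j :
  mxsupp a A -> mxsupp b B -> j < a + b + s%:Z ->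
  mxcoef j (A *m B) = \sum_(i < s) mxcoef (a + i%:Z) A *m mxcoef (j - (a + i%:Z)) B.
Proof.
move=> Aa Bb js; apply/matrixP => x y; rewrite summxE !mxE lcoef_sum.
rewrite (eq_bigr _ (fun z _ => lconvE (mxsuppE x z Aa) (mxsuppE z y Bb) js)).
rewrite exchange_big; apply: eq_bigr => i _; rewrite mxE.
by apply: eq_bigr => z _; rewrite !mxE.
Qed.

Lemma mxsuppM m n p (A : 'M[F]_(m, n)) (B : 'M[F]_(n, p)) a b :
  mxsupp a A -> mxsupp b B -> mxsupp (a + b) (A *m B).
Proof.
by move=> Aa Bb j ja; rewrite (mxcoefM (s := 0) Aa Bb) ?big_ord0 // addr0.
Qed.

Lemma mxcoef_algM m n p (M : 'M[k]_(m, n)) (B : 'M[F]_(n, p)) j :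
  mxcoef j (map_mx (in_alg F) M *m B) = M *m mxcoef j B.
Proof.
apply/matrixP => x y; rewrite !mxE lcoef_sum; apply: eq_bigr => z _.
by rewrite !mxE mulr_algl.
Qed.

Lemma mxcoef_Malg m n p (A : 'M[F]_(m, n)) (M : 'M[k]_(n, p)) j :
  mxcoef j (A *m map_mx (in_alg F) M) = mxcoef j A *m M.
Proof.
apply/matrixP => x y; rewrite !mxE lcoef_sum; apply: eq_bigr => z _.
by rewrite !mxE mulr_algr mulrC.
Qed.

Lemma dmxM m n p (A : 'M[F]_(m, n)) (B : 'M[F]_(n, p)) :
  dmx (A *m B) = dmx A *m B + A *m dmx B.
Proof.
apply/matrixP => i l; rewrite !mxE lderiv_sum -big_split /=.
by apply: eq_bigr => z _; rewrite !mxE lderivM.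
Qed.

Lemma mxsupp1 n : mxsupp 0 (1%:M : 'M[F]_n).
Proof.
move=> j j0; apply/matrixP => x y; rewrite !mxE.
by case: (x == y); rewrite ?mulr1n ?mulr0n //=; rewrite ifN //; lia.
Qed.

Lemma mxsupp_bracket n (A B : 'M[F]_n) a b :
  mxsupp a A -> mxsupp b B -> mxsupp (a + b) (lie_bracket A B).
Proof.
by move=> Aa Bb; apply: mxsuppB; [|rewrite addrC]; apply: mxsuppM.
Qed.

End LaurentMatrices.

(** * Gauge transformations *)

Section Gauge.
Variables (k : fieldType) (N : nat).
Hypothesis natk : forall m : nat, m.+1%:R != 0 :> k.
Local Notation F := (laurent k).
Local Notation dmx := (map_mx (@lderiv k)).
Implicit Types x y A X E : 'M[F]_N.

Lemma gauge_eqP x A B : x \in unitmx -> x *m A + dmx x = B *m x -> gauge x A = B.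
Proof.
by move=> Ux E; rewrite /gauge -mulmxDl E mulmxK.
Qed.

Lemma gaugeM x y A : x \in unitmx -> y \in unitmx ->
  gauge (x *m y) A = gauge x (gauge y A).
Proof.
move=> Ux Uy; apply: gauge_eqP; first by rewrite unitmx_mul Ux.
have yA : y *m A + dmx y = gauge y A *m y by rewrite /gauge -mulmxDl mulmxKV.
rewrite dmxM addrCA -mulmxA -mulmxDr yA /gauge -/(gauge y A) -mulmxDl.
by rewrite mulmxA -[_ *m invmx x *m _]mulmxA (mulKmx Ux) -mulmxDl addrC.
Qed.

(* Gauge transformations as conjugations: with prolong x = [x, x'; 0, x], the matrix
   prolong x conjugates [1, -A; 0, 0] to [1, -(x.A); 0, 0]. *)
Definition prolong x : 'M[F]_(N + N) := block_mx x (dmx x) 0 x.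
Definition prolong_conn A : 'M[F]_(N + N) := block_mx 1%:M (- A) 0 0.

Lemma prolongM x y : prolong (x *m y) = prolong x *m prolong y.
Proof.
by rewrite /prolong mulmx_block !mul0mx !mulmx0 !addr0 !add0r dmxM addrC.
Qed.

Lemma dmx1 : dmx 1%:M = 0 :> 'M[F]_N.
Proof.
have -> : 1%:M = map_mx (in_alg F) 1%:M :> 'M[F]_N by rewrite map_mx_alg1.
exact: dmx_alg.
Qed.

Lemma prolongX x i : prolong (x ^+ i) = prolong x ^+ i.
Proof.
elim: i => [|i IHi]; first by rewrite !expr0 /prolong dmx1 -scalar_mx_block.
by rewrite !exprS -IHi [LHS]prolongM.
Qed.

Lemma lderiv_ifact i : lderiv (ifact F i) = 0.
Proof. by rewrite /ifact lderivV ?lderiv_nat. Qed.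

Lemma prolong_mexp M X : prolong (mexp M X) = mexp M (prolong X).
Proof.
have p0 : prolong 0 = 0 by rewrite /prolong dmx0 block_mx_const.
have pD x y : prolong (x + y) = prolong x + prolong y.
  by rewrite /prolong add_block_mx addr0 dmxD.
rewrite /mexp (big_morph prolong pD p0); apply: eq_bigr => i _.
rewrite -prolongX /prolong scale_block_mx scaler0 dmxZ lderiv_ifact.
by rewrite scale0r add0r.
Qed.

Lemma prolong_conn_bracket X A :
  lie_bracket (prolong X) (prolong_conn A) =
  block_mx 0 (- (dmx X + lie_bracket X A)) 0 0.
Proof.
rewrite /lie_bracket /prolong /prolong_conn !mulmx_block !mul0mx !mulmx0 !addr0.
rewrite mulmx1 mul1mx mulmxN mulNmx opp_block_mx add_block_mx subrr !subr0.
by congr block_mx; rewrite mul1mx -opprD; congr (- _); rewrite addrCA.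
Qed.

Lemma prolong_iter_bracket X E i :
  iter i (lie_bracket (prolong X)) (block_mx 0 E 0 0) =
  block_mx 0 (iter i (lie_bracket X) E) 0 0.
Proof.
elim: i => //= i ->; rewrite /lie_bracket /prolong !mulmx_block !mul0mx !mulmx0.
by rewrite !addr0 ?add0r opp_block_mx add_block_mx !subr0 ?addr0.
Qed.

(** The upper right block of Ad(exp Z) = exp(ad Z) for Z = [prolong X]. The first bracket of Z with
    [prolong_conn A] already produces E = X' + [X, A], hence the factorial of i + 1 with only i
    brackets. *)
Lemma gauge_mexp M X A : X ^+ M = 0 ->
  gauge (mexp M X) A =
  A + \sum_(i < M + M.+1) ifact F i.+1 *: iter i (lie_bracket X) (dmx X + lie_bracket X A).
Proof.
move=> XM; set E := dmx X + _; set S := \sum_(i < _) _.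
have XM1 : X ^+ M.+1 = 0 by rewrite exprS XM mulr0.
have exp_unit := mexp_unit (natF natk) XM; apply: gauge_eqP => //.
(* M + 1 terms instead of M, so that the sum in [mexp_conj] has a term of index 0 to split off even
   for M = 0. *)
rewrite -(mexp_widen XM (leqnSn M)); set x := mexp M.+1 X.
have := mexp_conj (natF natk) (prolong_conn A) (etrans (esym (prolongX X M.+1)) _).
have p0 : prolong 0 = 0 by rewrite /prolong dmx0 block_mx_const.
rewrite XM1 => /(_ p0); rewrite -prolong_mexp addSn big_ord_recl /=.
rewrite [X in _ = (_ + X) * _](_ : _ = block_mx 0 (- S) 0 0); last first.
  have b0 : block_mx 0 0 0 0 = 0 :> 'M[F]_(N + N) by rewrite block_mx_const.
  have bD (Y Z : 'M[F]_N) :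
      block_mx 0 (Y + Z) 0 0 = block_mx 0 Y 0 0 + block_mx 0 Z 0 0 :> 'M[F]_(N + N).
    by rewrite add_block_mx !addr0.
  rewrite /S -sumrN (big_morph (fun Z => block_mx 0 Z 0 0) bD b0).
  apply: eq_bigr => i _; rewrite /bump /= add1n -iterS iterSr prolong_conn_bracket.
  rewrite prolong_iter_bracket scale_block_mx !scaler0 -scalerN; congr (block_mx 0 (_ *: _) 0 0).
  elim: (i : nat) => //= j ->; by rewrite /lie_bracket mulmxN mulNmx [RHS]opprD.
rewrite [ifact F _](_ : _ = 1) ?scale1r; last by rewrite /ifact fact0 invr1.
rewrite add_block_mx !addr0.
rewrite [LHS]mulmx_block [RHS]mulmx_block => /eq_block_mx [_ + _ _].
rewrite -/x mulmx0 mul1mx addr0 mulmxN -opprD mulNmx => xA.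
by rewrite -[x *m A]opprK xA opprB subrK.
Qed.

End Gauge.

(** * First order linear differential equations *)

(** Course-of-values recursion, for coefficients that depend on all the previous ones. *)
Lemma seq_rec (T : Type) (Phi : nat -> seq T -> T) :
  exists x : nat -> T, forall n, x n = Phi n (mkseq x n).
Proof.
pose fix l n := if n is n'.+1 then rcons (l n') (Phi n' (l n')) else [::].
exists (fun n => Phi n (l n)) => n; congr (Phi n _).
elim: n => //= n IHn; rewrite {1}IHn /mkseq -[in RHS]addn1 iotaD map_cat /=.
by rewrite cats1 add0n.
Qed.

Section Ode.
Variables (k : fieldType) (m n : nat).
Local Notation F := (laurent k).
Local Notation dmx := (map_mx (@lderiv k)).

Definition subspace (W : 'M[k]_(m, n) -> Prop) : Prop :=
  [/\ W 0, forall X Y, W X -> W Y -> W (X + Y) & forall c X, W X -> W (c *: X)].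

(* W (x) F *)
Definition overF (W : 'M[k]_(m, n) -> Prop) (A : 'M[F]_(m, n)) : Prop :=
  forall j, W (mxcoef j A).

Lemma subspace_sum W I (r : seq I) (P : pred I) (G : I -> 'M[k]_(m, n)) :
  subspace W -> (forall i, P i -> W (G i)) -> W (\sum_(i <- r | P i) G i).
Proof. by case=> W0 WD _ WG; apply: big_ind. Qed.

Lemma mx_of_coefs (c : int -> 'M[k]_(m, n)) (e : int) :
  (forall j, j < e -> c j = 0) -> exists A : 'M[F]_(m, n), forall j, mxcoef j A = c j.
Proof.
move=> ce.
have cb x y : exists a : int, forall j : int, j < a -> c j x y = 0.
  by exists e => j /ce ->; rewrite mxE.
exists (\matrix_(x, y) Laurent (cb x y)) => j.
by apply/matrixP => x y; rewrite !mxE.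
Qed.

(** Regular singular or irregular. In the second case the leading term of g dominates the derivative
    and no resonance can occur. *)
Lemma pole_order (g : F) : (forall i, i < -1 -> g i = 0) \/
  exists s : nat, [/\ (1 < s)%N, lsupp g (- s%:Z) & g (- s%:Z) != 0].
Proof.
have [a ga] := lsupp_ex g.
have [|/existsNP[i /not_implyP[i1 /eqP gi]]] := pselect (forall i, i < -1 -> g i = 0).
  by left.
right; have ai : a <= i by rewrite leNgt; apply: contra gi => /ga ->.
have ex : exists d : nat, g (a + d%:Z) != 0.
  by exists `|(i - a)%R|%N; rewrite gez0_abs ?subr_ge0 // addrC subrK.
have [d gd dmin] := ex_minnP ex.
have di : (d <= `|(i - a)%R|)%N.
  by apply: dmin; rewrite gez0_abs ?subr_ge0 // addrC subrK.
exists `|(a + d%:Z)%R|%N; have -> : - `|(a + d%:Z)%R|%N%:Z = a + d%:Z by lia.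
split=> //; first by lia.
move=> j jd; case: (ltP j a) => [/ga //|aj]; apply/eqP; apply: contraT => gj.
have Ej : j = a + `|(j - a)%R|%N%:Z by lia.
by rewrite Ej in gj; have := dmin _ gj; lia.
Qed.

(** Let s be the pole order of g, or 1 if the pole is at most simple. In the coefficient of
    t^(e+1+l-s), the new unknown x_l, the coefficient of t^(e+1+l) in X, is multiplied by (e+1+l) -
    g(-1) if s = 1 and by -g(-s) if s > 1. This is nonzero, so the recursion runs; being linear, it
    stays in W. *)
Lemma ode_solve (W : 'M[k]_(m, n) -> Prop) (g : F) (D : 'M[F]_(m, n)) (e : int) :
  subspace W -> overF W D -> mxsupp e D ->
  ((forall i, i < -1 -> g i = 0) -> forall j : int, e < j -> j%:~R != g (-1)) ->
  exists X, [/\ mxsupp (e + 1) X, overF W X & dmx X - g *: X = D].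
Proof.
move=> WS WD De res; have [W0 WA WZ] := WS.
have [s [s0 gs lam]] : exists s : nat, [/\ (0 < s)%N, lsupp g (- s%:Z) &
    forall l : nat, (if s == 1%N then (e + 1 + l%:Z)%:~R else 0) - g (- s%:Z) != 0].
  have [g1|[s [s1 gs gs0]]] := pole_order g.
    exists 1%N; split=> [||l] //=; rewrite ?subr_eq0; apply: res => //; lia.
  exists s; split=> // [|l]; first by apply: ltnW.
  by rewrite ifN ?sub0r ?oppr_eq0 //; lia.
pose L l : k := (if s == 1%N then (e + 1 + l%:Z)%:~R else 0) - g (- s%:Z).
(* For s > 1 the derivative contributes only the earlier unknown x_(l-s+1), and nothing while l < s
   - 1. For s = 1 its contribution is part of [L l]. *)
pose Phi l (x : seq 'M[k]_(m, n)) := (L l)^-1 *: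
  (mxcoef (e + 1 + l%:Z - s%:Z) D
   - (if (1 < s)%N && (s.-1 <= l)%N then (e + 1 + l%:Z - s%:Z + 1)%:~R *: x`_(l - s.-1)
      else 0)
   + \sum_(i < l) g (- s%:Z + i.+1%:Z) *: x`_(l - i.+1)).
have [x xP] := seq_rec Phi.
have Wx l : W (x l).
  elim/ltn_ind: l => l IHl; rewrite xP; apply: (WZ); apply: (WA); last first.
    apply: subspace_sum => // i _; apply: (WZ); have := ltn_ord i => il.
    by rewrite nth_mkseq; [apply: IHl|]; lia.
  apply: (WA) => //; rewrite -scaleN1r; apply: (WZ).
  case: ifP => // /andP[s1 sl]; apply: (WZ).
  by rewrite nth_mkseq; [apply: IHl|]; lia.
pose c (j : int) := if j < e + 1 then 0 else x `|(j - (e + 1))%R|%N.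
have c0 j : j < e + 1 -> c j = 0 by rewrite /c => ->.
have cx l : c (e + 1 + l%:Z) = x l.
  by rewrite /c ifN; [congr x; lia | lia].
have [X XE] := mx_of_coefs c0; exists X.
have Xe : mxsupp (e + 1) X by move=> j je; rewrite XE c0.
split=> // [j|]; first by rewrite XE /c; case: ifP.
apply: mxP => j; rewrite mxcoefB mxcoef_deriv.
have [js|js] := ltP j (e + 1 - s%:Z).
  rewrite De; last by lia.
  rewrite (mxsuppZ gs Xe); last by lia.
  by rewrite Xe ?scaler0 ?subr0 //; lia.
pose l := `|(j - (e + 1 - s%:Z))%R|%N.
have jl : j = e + 1 + l%:Z - s%:Z by lia.
rewrite (mxcoefZ (s := l.+1) gs Xe); last by lia.
rewrite big_ord_recl; have -> : - s%:Z + (@ord0 l)%:Z = - s%:Z by rewrite /=; lia.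
have -> : j - - s%:Z = e + 1 + l%:Z by lia.
have -> : \sum_(i < l) g (- s%:Z + (lift ord0 i)%:Z) *: mxcoef (j - (- s%:Z + (lift ord0 i)%:Z)) X
   = \sum_(i < l) g (- s%:Z + i.+1%:Z) *: (mkseq x l)`_(l - i.+1).
  apply: eq_bigr => i _; have il := ltn_ord i; rewrite nth_mkseq; last by lia.
  rewrite /= /bump /= add1n XE -cx; congr (_ *: c _); lia.
have := xP l; rewrite /Phi -jl => /(congr1 ( *:%R (L l))).
rewrite scalerA mulfV ?lam // scale1r /L !XE cx.
set S := \sum_(i < l) _; set Dj := mxcoef j D => E.
have {E} : (if s == 1%N then (e + 1 + l%:Z)%:~R else 0) *: x l
   + (if (1 < s)%N && (s.-1 <= l)%N then (j + 1)%:~R *: (mkseq x l)`_(l - s.-1) else 0)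
   - g (- s%:Z) *: x l - S = Dj.
  set y := (if _ && _ then _ else _) in E *; rewrite (addrAC _ y) -scalerBl E.
  by rewrite [Dj - y + S]addrAC subrK addrK.
move=> <-; rewrite opprD addrA; congr (_ - _ - _).
case: eqP => s1.
  by rewrite s1 addr0; have -> : j + 1 = e + 1 + l%:Z; [lia | rewrite cx].
rewrite scale0r add0r; case: ifP => [/andP[_ sl]|sl].
  have -> : j + 1 = e + 1 + (l - s.-1)%N%:Z by lia.
  by rewrite cx nth_mkseq //; lia.
by rewrite c0 ?scaler0 //; lia.
Qed.

End Ode.

(** * Laurent matrices with coefficients in a subspace *)

Section OverF.
Variables (k : fieldType) (N : nat).
Local Notation F := (laurent k).
Local Notation dmx := (map_mx (@lderiv k)).
Implicit Types (W : 'M[k]_N -> Prop) (A B X Y : 'M[F]_N) (U G : alg_group k N).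

Lemma overFD W A B : subspace W -> overF W A -> overF W B -> overF W (A + B).
Proof. by case=> _ WD _ WA WB j; rewrite mxcoefD; apply: WD. Qed.

Lemma overF0 W : subspace W -> overF W 0.
Proof. by case=> W0 _ _ j; rewrite mxcoef0. Qed.

Lemma overFZ W (f : F) A : subspace W -> overF W A -> overF W (f *: A).
Proof.
move=> WS WA j; have [[a fa] [b Ab]] := (lsupp_ex f, mxsupp_ex A).
rewrite (mxcoefZ (s := `|(j - a - b)%R|%N.+1) fa Ab); last by lia.
by apply: subspace_sum => // i _; case: WS => _ _ WZ; apply: WZ.
Qed.

Lemma overFN W A : subspace W -> overF W A -> overF W (- A).
Proof. by move=> WS WA; rewrite -scaleN1r; apply: overFZ. Qed.

Lemma overFB W A B : subspace W -> overF W A -> overF W B -> overF W (A - B).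
Proof. by move=> WS WA WB; apply: overFD => //; apply: overFN. Qed.

Lemma overF_sum W I (r : seq I) (P : pred I) (G : I -> 'M[F]_N) :
  subspace W -> (forall i, P i -> overF W (G i)) -> overF W (\sum_(i <- r | P i) G i).
Proof.
by move=> WS WG; apply: big_ind => //; [exact: overF0|move=> A B; exact: overFD].
Qed.

Lemma mxcoef_bracket X Y a b (n : nat) j : mxsupp a X -> mxsupp b Y ->
  j = a + b + n%:Z ->
  mxcoef j (lie_bracket X Y) =
  \sum_(i < n.+1) lie_bracket (mxcoef (a + i%:Z) X) (mxcoef (j - (a + i%:Z)) Y).
Proof.
move=> Xa Yb jn; rewrite mxcoefB.
rewrite (mxcoefM (s := n.+1) Xa Yb) ?(mxcoefM (s := n.+1) Yb Xa); try by lia.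
rewrite [X in _ - X](reindex_inj rev_ord_inj) /= -sumrB.
apply: eq_bigr => i _; have := ltn_ord i => il; rewrite /lie_bracket.
have -> : b + (n.+1 - i.+1)%N%:Z = j - (a + i%:Z) by lia.
by have -> : j - (j - (a + i%:Z)) = a + i%:Z by lia.
Qed.

Lemma overF_bracket (W1 W2 W3 : 'M[k]_N -> Prop) X Y : subspace W3 ->
  (forall M M', W1 M -> W2 M' -> W3 (lie_bracket M M')) ->
  overF W1 X -> overF W2 Y -> overF W3 (lie_bracket X Y).
Proof.
move=> W3S W123 WX WY j; have [[a Xa] [b Yb]] := (mxsupp_ex X, mxsupp_ex Y).
have [jab|jab] := ltP j (a + b); first by rewrite (mxsupp_bracket Xa Yb jab); case: W3S.
rewrite (mxcoef_bracket (n := `|(j - a - b)%R|%N) Xa Yb); last by lia.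
by apply: subspace_sum => // i _; apply: W123.
Qed.

Lemma subspace_Lie U : subspace (Lie U).
Proof.
split=> [|X Y /LieE XU /LieE YU|c X /LieE XU]; apply/LieE.
- exact: LieR0.
- exact: (LieRD (R := k^o)).
- exact: (LieRZ (R := k^o)).
Qed.

Lemma LieFE U A : LieF U A <-> LieR U A.
Proof.
have E p j : (\sum_(i < N * N) lcoefp i p *: mxvec A 0 i) j =
    \sum_(i < N * N) lcoefp i p *: (mxvec (mxcoef j A) 0 i : k^o).
  rewrite lcoef_sum; apply: eq_bigr => i _.
  by case/mxvec_indexP: i => x y; rewrite !mxvecE mxE.
split=> [AU p Up|AU j].
  by apply: laurentP => j; rewrite E; have /LieE := AU j; apply.
by apply/LieE => p Up; rewrite -E AU.
Qed.

Lemma lie_bracketDl (R : pzRingType) n (X Y Z : 'M[R]_n) :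
  lie_bracket (X + Y) Z = lie_bracket X Z + lie_bracket Y Z.
Proof. by rewrite /lie_bracket mulmxDl mulmxDr opprD addrACA. Qed.

Lemma lie_bracketDr (R : pzRingType) n (X Y Z : 'M[R]_n) :
  lie_bracket Z (X + Y) = lie_bracket Z X + lie_bracket Z Y.
Proof. by rewrite /lie_bracket mulmxDl mulmxDr opprD addrACA. Qed.

Lemma lie_bracketZl (R : comPzRingType) n c (X Z : 'M[R]_n) :
  lie_bracket (c *: X) Z = c *: lie_bracket X Z.
Proof. by rewrite /lie_bracket -scalemxAl -scalemxAr scalerBr. Qed.

Lemma lie_bracket0 (R : pzRingType) n (Z : 'M[R]_n) : lie_bracket 0 Z = 0.
Proof. by rewrite /lie_bracket mul0mx mulmx0 subrr. Qed.

Lemma subspace_central U d : subspace (lie_central U d).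
Proof.
elim: d => [|d [W0 WD WZ]] /=.
  by split=> [|X Y -> ->|c X ->] //; rewrite ?addr0 ?scaler0.
have [L0 LD LZ] := subspace_Lie U; split=> [|X Y [XU XW] [YU YW]|c X [XU XW]].
- by split=> // Y _; rewrite lie_bracket0.
- by split=> [|Z ZU]; [exact: LD | rewrite lie_bracketDl; apply: WD; auto].
- by split=> [|Z ZU]; [exact: LZ | rewrite lie_bracketZl; apply: WZ; auto].
Qed.

Lemma mxcoef_alg (M : 'M[k]_N) j :
  mxcoef j (map_mx (in_alg F) M) = if j == 0 then M else 0.
Proof. by rewrite -mxcoef_lmonoZ -[lmono 1 0]/(1 : F) scale1r. Qed.

Lemma overF_alg W (M : 'M[k]_N) : W 0 -> W M -> overF W (map_mx (in_alg F) M).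
Proof. by move=> W0 WM j; rewrite mxcoef_alg; case: ifP. Qed.

Lemma central_Lie U d (X : 'M[k]_N) : lie_central U d X -> Lie U X.
Proof. by case: d => [/= ->|d []] //; case: (subspace_Lie U). Qed.

Lemma LieF_Ad U G (g A : 'M[F]_N) : normalizes G U -> points G g -> LieF U A ->
  LieF U (g *m A *m invmx g).
Proof. by move=> nGU Gg /LieFE AU; apply/LieFE; apply: (LieR_Ad nGU Gg). Qed.

Lemma lie_bracket_conj (R : comUnitRingType) n (g A B : 'M[R]_n) : g \in unitmx ->
  lie_bracket (g *m A *m invmx g) B =
  g *m lie_bracket A (invmx g *m B *m g) *m invmx g.
Proof.
move=> Ug; rewrite /lie_bracket mulmxBr mulmxBl !mulmxA.
by rewrite mulmxK // mulmxV // mul1mx.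
Qed.

Lemma mxcoef_bracket_alg A (Y : 'M[k]_N) j :
  mxcoef j (lie_bracket A (map_mx (in_alg F) Y)) = lie_bracket (mxcoef j A) Y.
Proof. by rewrite [LHS]mxcoefB (mxcoef_algM Y A) (mxcoef_Malg A Y). Qed.

(** Induction through [g A g^-1, Y] = g [A, g^-1 Y g] g^-1. As g has entries in F, the matrix g^-1 Y
    g need not be constant even for Y over k; hence the formulation over F. *)
Lemma central_Ad U G d (g A : 'M[F]_N) : normalizes G U -> points G g ->
  overF (lie_central U d) A -> overF (lie_central U d) (g *m A *m invmx g).
Proof.
move=> nGU; elim: d g A => [|d IHd] g A Gg AW.
  have -> : A = 0 by apply: mxP => j; rewrite mxcoef0 AW.
  by rewrite mulmx0 mul0mx => j; rewrite mxcoef0.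
have [Ug _] := Gg; move=> j; split=> [|Y YU].
  by apply: (LieF_Ad nGU Gg) => i; have [] := AW i.
rewrite -mxcoef_bracket_alg (lie_bracket_conj _ _ Ug); apply: (IHd g) => //.
apply: (overF_bracket (W1 := lie_central U d.+1) (W2 := Lie U)) => //.
- exact: subspace_central.
- by move=> M M' [_]; apply.
have := LieF_Ad nGU (pointsV Gg) (overF_alg _ YU).
by rewrite invmxK; apply; case: (subspace_Lie U).
Qed.

End OverF.

(** * Weights of the torus *)

Lemma sum_pick (V : nmodType) (J : eqType) (t : seq J) (j0 : J) (x : V) :
  uniq t -> j0 \in t -> \sum_(j <- t) (if j0 == j then x else 0) = x.
Proof.
move=> t_uniq j0t; rewrite (bigD1_seq j0) //= eqxx big1 ?addr0 // => j jj0.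
by rewrite eq_sym (negbTE jj0).
Qed.

Lemma sum_fiber (V : nmodType) (I J : eqType) (s : seq I) (t : seq J) (h : I -> J)
    (G : I -> V) : uniq t -> {in s, forall i, h i \in t} ->
  \sum_(i <- s) G i = \sum_(j <- t) \sum_(i <- s | h i == j) G i.
Proof.
move=> t_uniq; elim: s => [|i s IHs] ht.
  by rewrite big_nil big1 // => j _; rewrite big_nil.
rewrite big_cons IHs => [|l ls]; last by apply: ht; rewrite inE ls orbT.
rewrite -{1}(sum_pick (G i) t_uniq (ht i (mem_head _ _))) -big_split /=.
by apply: eq_bigr => j _; rewrite big_cons; case: ifP; rewrite ?add0r.
Qed.

Section Pairing.
Variable r : nat.
Implicit Types a b nu : 'rV[int]_r.

Lemma pairingDl nu nu' a : pairing (nu + nu') a = pairing nu a + pairing nu' a.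
Proof. by rewrite -big_split; apply: eq_bigr => i _; rewrite mxE mulrDl. Qed.

Lemma pairingBr nu a b : pairing nu (a - b) = pairing nu a - pairing nu b.
Proof. by rewrite -sumrB; apply: eq_bigr => i _; rewrite !mxE mulrBr. Qed.

(* A cocharacter (1, x, x^2, ...), for x outside the roots of finitely many polynomials. *)
Lemma separating_cochar (s : seq 'rV[int]_r) :
  exists nu : 'rV[int]_r, {in s &, injective (pairing nu)}.
Proof.
pose D := [seq d <- [seq a - b | a <- s, b <- s] | d != 0].
pose P : {poly int} := \prod_(d <- D) rVpoly d.
have P0 : P != 0.
  rewrite prodf_seq_neq0; apply/allP => d; rewrite mem_filter => /andP[d0 _].
  by apply: contra d0 => /eqP d0; rewrite -[d]rVpolyK d0 linear0.
have [x xP] : exists x : int, ~~ root P x.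
  pose rs : seq int := [seq i%:Z | i <- iota 0 (size P)].
  have /allPn[x _ xP] : ~~ all (root P) rs; last by exists x.
  apply/negP => rsP; have := max_poly_roots P0 rsP.
  rewrite map_inj_uniq ?iota_uniq; last by move=> i j [].
  by move=> /(_ isT); rewrite size_map size_iota ltnn.
exists (\row_i x ^+ i) => a b sa sb ab; apply/eqP; rewrite -subr_eq0.
apply: contraNT xP => d0; rewrite /root /P horner_prod.
have Dd : a - b \in D by rewrite mem_filter d0 (allpairs_f (fun a b => a - b) sa sb).
rewrite (big_rem _ Dd) /= (_ : (rVpoly (a - b)).[x] = 0) ?mul0r //.
transitivity (pairing (\row_i x ^+ i) (a - b)); last by rewrite pairingBr ab subrr.
rewrite (@horner_coef_wide _ r) ?size_poly //.
by apply: eq_bigr => i _; rewrite coef_rVpoly_ord [X in _ = X * _]mxE mulrC.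
Qed.

End Pairing.

Lemma pairing_row_mx r1 r2 (nu1 a1 : 'rV[int]_r1) (nu2 a2 : 'rV[int]_r2) :
  pairing (row_mx nu1 nu2) (row_mx a1 a2) = pairing nu1 a1 + pairing nu2 a2.
Proof.
rewrite /pairing big_split_ord /=; congr (_ + _); apply: eq_bigr => i _.
  by rewrite !row_mxEl.
by rewrite !row_mxEr.
Qed.

Section Monomials.
Variables (k : fieldType) (r : nat).
Implicit Types (a b nu : 'rV[int]_r) (R : comUnitAlgType k).

Lemma monomial_at_unit R a (z : 'rV[R]_r) : gm_point z ->
  monomial_at a z \is a GRing.unit.
Proof. by move=> Uz; apply: rpred_prod => i _; rewrite unitrXz. Qed.

Lemma monomial_atB R a b (z : 'rV[R]_r) : gm_point z ->
  monomial_at (a - b) z = monomial_at a z * (monomial_at b z)^-1.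
Proof.
move=> Uz; apply: (canRL (mulrK (monomial_at_unit b Uz))).
rewrite -big_split; apply: eq_bigr => i _ /=.
by rewrite -exprzDr ?Uz // !mxE subrK.
Qed.

Lemma monomial_at1 R a : monomial_at a (const_mx 1 : 'rV[R]_r) = 1.
Proof. by rewrite /monomial_at big1 // => i _; rewrite mxE exp1rz. Qed.

Lemma lmono1_neq0 (d : int) : lmono (1 : k) d != 0.
Proof. by apply/eqP => /(congr1 (fun f : laurent k => f d)) /= /eqP; rewrite eqxx oner_eq0. Qed.

Lemma lmonoV (d : int) : (lmono (1 : k) d)^-1 = lmono 1 (- d).
Proof.
apply: (mulfI (lmono1_neq0 d)); rewrite mulfV ?lmono1_neq0 //.
by rewrite lmonoM mul1r subrr.
Qed.

Lemma lmono_exprz (d e : int) : lmono (1 : k) d ^ e = lmono 1 (d * e).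
Proof.
have expn (d' : int) (n : nat) : lmono (1 : k) d' ^+ n = lmono 1 (d' * n%:Z).
  elim: n => [|n IHn]; first by rewrite expr0 mulr0.
  by rewrite exprS IHn lmonoM mul1r intS mulrDr mulr1.
case: e => n; first exact: expn.
rewrite NegzE -exprz_inv lmonoV mulrN -mulNr; exact: expn.
Qed.

(** The cocharacter nu evaluated at t. Characters take powers of t as values there, so a coefficient
    of a Laurent series isolates a character when nu separates those that occur. *)
Definition gm_mono nu : 'rV[laurent k]_r := \row_i lmono 1 (nu 0 i).

Lemma gm_mono_point nu : gm_point (gm_mono nu).
Proof. by move=> i; rewrite mxE unitfE lmono1_neq0. Qed.

Lemma monomial_at_mono a nu : monomial_at a (gm_mono nu) = lmono 1 (pairing nu a).
Proof.
rewrite /monomial_at /pairing.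
rewrite (big_morph (fun d => lmono (1 : k) d : laurent k) (id1 := 1) (op1 := *%R)) //.
  by apply: eq_bigr => i _; rewrite mxE lmono_exprz.
by move=> d e; rewrite lmonoM mul1r.
Qed.

Lemma monomial_at_map R R' (f : {rmorphism R -> R'}) a (z : 'rV[R]_r) : gm_point z ->
  f (monomial_at a z) = monomial_at a (map_mx f z).
Proof.
by move=> Uz; rewrite rmorph_prod; apply: eq_bigr => i _; rewrite mxE rmorphXz ?Uz.
Qed.

Lemma monomial_at_dual R a (c : 'rV[R]_r) :
  monomial_at a (map_mx (Dual 1) c : 'rV[dual R]_r) = Dual 1 (\sum_i (a 0 i)%:~R * c 0 i).
Proof.
have dM (x y : R) : Dual 1 (x + y) = Dual 1 x * Dual 1 y.
  by congr Dual; rewrite /= !mul1r ?mulr1 // addrC.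
have dV (x : R) : Dual 1 x * Dual 1 (- x) = 1 by rewrite -dM subrr.
have dX (x : R) (n : nat) : Dual 1 x ^+ n = Dual 1 (n%:R * x).
  elim: n => [|n IHn]; first by rewrite expr0 mul0r.
  by rewrite exprS IHn -dM -[n.+1]add1n natrD mulrDl mul1r.
rewrite (big_morph (Dual 1) dM (erefl : Dual 1 0 = 1)).
apply: eq_bigr => i _; rewrite mxE; move: (a 0 i) (c 0 i) => n x.
case: n => n; first exact: dX.
rewrite NegzE -exprz_inv (_ : (Dual 1 x)^-1 = Dual 1 (- x)).
  by rewrite [LHS]dX rmorphN mulNr mulrN.
have Ux : Dual 1 x \is a GRing.unit by apply/unitrP; exists (Dual 1 (- x)); rewrite [X in X = _]mulrC dV.
by rewrite -[RHS](mulKr Ux) dV mulr1.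
Qed.

End Monomials.

Section Torus.
Variables (k : fieldType) (N r : nat) (T : alg_group k N) (phi : gm_morphism k N r).
Hypothesis T_iso : torus_iso T phi.
Local Notation F := (laurent k).
Local Notation dmx := (map_mx (@lderiv k)).
Local Notation base R M := (map_mx (in_alg R) M).
Implicit Types (a b d nu : 'rV[int]_r) (R : comUnitAlgType k).

Definition tchars : seq 'rV[int]_r := undup [seq aM.1 | aM <- phi].

(* The projection of k^N to the weight space of a. *)
Definition tproj a : 'M[k]_N := \sum_(aM <- phi | aM.1 == a) aM.2.

Lemma sum_phi (V : nmodType) (G : 'rV[int]_r * 'M[k]_N -> V) :
  \sum_(aM <- phi) G aM = \sum_(a <- tchars) \sum_(aM <- phi | aM.1 == a) G aM.
Proof.
apply: sum_fiber => [|aM aMphi]; first exact: undup_uniq.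
by rewrite mem_undup map_f.
Qed.

Lemma gm_evalE R (z : 'rV[R]_r) :
  gm_eval phi z = \sum_(a <- tchars) monomial_at a z *: base R (tproj a).
Proof.
rewrite /gm_eval sum_phi; apply: eq_bigr => a _.
rewrite raddf_sum scaler_sumr; apply: eq_bigr => aM /eqP <-.
by [].
Qed.

Lemma mxcoef_gm_mono nu j :
  mxcoef j (gm_eval phi (gm_mono k nu)) =
  \sum_(a <- tchars) (if j == pairing nu a then tproj a else 0).
Proof.
rewrite gm_evalE mxcoef_sum; apply: eq_bigr => a _.
by rewrite monomial_at_mono mxcoef_lmonoZ.
Qed.

(** Expand phi(z) phi(w) = phi(zw) at z = nu1(t) and w = nu2(t), where (nu1, nu2) separates pairs of
    characters, and compare coefficients of t^(<nu1, a> + <nu2, b>). On the right only the pair (c,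
    c) = (a, b) can contribute. *)
Lemma tproj_mul a b : a \in tchars -> b \in tchars ->
  tproj a *m tproj b = if a == b then tproj a else 0.
Proof.
move=> aS bS.
have [nu nu_inj] := separating_cochar [seq row_mx c d | c <- tchars, d <- tchars].
pose nu1 := lsubmx nu; pose nu2 := rsubmx nu.
have inj c c' d d' : c \in tchars -> c' \in tchars -> d \in tchars -> d' \in tchars ->
    (pairing nu1 c + pairing nu2 d == pairing nu1 c' + pairing nu2 d') =
    (c == c') && (d == d').
  move=> cS c'S dS d'S; rewrite -!pairing_row_mx !hsubmxK.
  apply/eqP/andP => [/nu_inj|[/eqP -> /eqP ->] //].
  by rewrite !(allpairs_f (fun c d => row_mx c d)) // => /(_ isT isT)/eq_row_mx[-> ->].
have [_ phiM _ _] := T_iso F.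
have := phiM _ _ (gm_mono_point k nu1) (gm_mono_point k nu2).
have -> : \row_i (gm_mono k nu1 0 i * gm_mono k nu2 0 i) = gm_mono k (nu1 + nu2).
  by apply/rowP => i; rewrite !mxE lmonoM mul1r.
move=> /(congr1 (mxcoef (pairing nu1 a + pairing nu2 b))).
rewrite mxcoef_gm_mono (_ : mxcoef _ (_ *m _) = tproj a *m tproj b).
  move=> <-; rewrite (eq_big_seq (fun c => if a == c then (if a == b then tproj a else 0) else 0)).
    by rewrite sum_pick ?undup_uniq.
  move=> c cS; rewrite pairingDl inj //; case: eqP => //= <-.
  by rewrite eq_sym.
rewrite !gm_evalE mulmx_suml mxcoef_sum.
rewrite -[RHS](sum_pick _ (undup_uniq _) aS); apply: eq_big_seq => c cS.
rewrite mulmx_sumr mxcoef_sum -[tproj a *m _](sum_pick _ (undup_uniq _) bS).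
case: ifP => [/eqP <-|/negbT ac]; [apply: eq_big_seq | rewrite big_seq big1 //] => d dS;
  rewrite !monomial_at_mono -scalemxAl -scalemxAr scalerA lmonoM mul1r -map_mxM mxcoef_lmonoZ inj //.
  by rewrite eqxx; case: eqP => // ->.
by rewrite (negbTE ac).
Qed.

Lemma gm_point1 R : gm_point (const_mx 1 : 'rV[R]_r).
Proof. by move=> i; rewrite mxE unitr1. Qed.

(** phi(1) is idempotent and invertible. *)
Lemma gm_eval1 R : gm_eval phi (const_mx 1 : 'rV[R]_r) = 1%:M.
Proof.
have [phiT phiM _ _] := T_iso R.
have [U1 _] := phiT _ (gm_point1 R).
have := phiM _ _ (gm_point1 R) (gm_point1 R).
have -> : \row_i ((const_mx 1 : 'rV[R]_r) 0 i * (const_mx 1 : 'rV[R]_r) 0 i) = const_mx 1.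
  by apply/rowP => i; rewrite !mxE mul1r.
by move=> /(congr1 (mulmx (invmx (gm_eval phi (const_mx 1))))); rewrite mulVmx // mulKmx.
Qed.

Lemma sum_tproj R : \sum_(a <- tchars) base R (tproj a) = 1%:M.
Proof.
rewrite -gm_eval1 gm_evalE; apply: eq_bigr => a _.
by rewrite monomial_at1 scale1r.
Qed.

Lemma base_tproj_mul R a b : a \in tchars -> b \in tchars ->
  base R (tproj a) *m base R (tproj b) = if a == b then base R (tproj a) else 0.
Proof. by move=> aS bS; rewrite -map_mxM tproj_mul //; case: ifP; rewrite ?map_mx0. Qed.

Lemma lincomb_tproj R (G : 'rV[int]_r -> R) a : a \in tchars ->
  (\sum_(b <- tchars) G b *: base R (tproj b)) *m base R (tproj a) = G a *: base R (tproj a).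
Proof.
move=> aS; rewrite mulmx_suml -[RHS](sum_pick _ (undup_uniq _) aS).
apply: eq_big_seq => b bS; rewrite -scalemxAl base_tproj_mul // eq_sym.
by case: eqP => [->|_]; rewrite ?scaler0.
Qed.

Lemma tproj_lincomb R (G : 'rV[int]_r -> R) a : a \in tchars ->
  base R (tproj a) *m (\sum_(b <- tchars) G b *: base R (tproj b)) = G a *: base R (tproj a).
Proof.
move=> aS; rewrite mulmx_sumr -[RHS](sum_pick _ (undup_uniq _) aS).
apply: eq_big_seq => b bS; rewrite -scalemxAr base_tproj_mul //.
by case: eqP => [->|_]; rewrite ?scaler0.
Qed.

Lemma invmx_gm_eval R (z : 'rV[R]_r) : gm_point z ->
  invmx (gm_eval phi z) = \sum_(a <- tchars) (monomial_at a z)^-1 *: base R (tproj a).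
Proof.
move=> Uz; have [phiT _ _ _] := T_iso R; have [Ug _] := phiT _ Uz.
rewrite -[RHS](mulKmx Ug) -[LHS]mulmx1; congr (_ *m _).
rewrite gm_evalE mulmx_sumr -(sum_tproj R).
apply: eq_big_seq => a aS; rewrite -scalemxAr lincomb_tproj // scalerA.
by rewrite mulVr ?monomial_at_unit // scale1r.
Qed.

(* The component of weight d of a matrix under conjugation by T. *)
Definition tcomp R d (A : 'M[R]_N) : 'M[R]_N :=
  \sum_(a <- tchars) \sum_(b <- tchars | a - b == d)
    base R (tproj a) *m A *m base R (tproj b).

Definition tweights : seq 'rV[int]_r := undup [seq a - b | a <- tchars, b <- tchars].

Lemma sum_tweights (V : nmodType) (G : 'rV[int]_r -> 'rV[int]_r -> V) :
  \sum_(a <- tchars) \sum_(b <- tchars) G a b =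
  \sum_(d <- tweights) \sum_(a <- tchars) \sum_(b <- tchars | a - b == d) G a b.
Proof.
rewrite [RHS]exchange_big /=; apply: eq_big_seq => a aS.
apply: sum_fiber => [|b bS]; first exact: undup_uniq.
by rewrite mem_undup (allpairs_f (fun a b => a - b)).
Qed.

Lemma sum_tcomp R (A : 'M[R]_N) : A = \sum_(d <- tweights) tcomp d A.
Proof.
rewrite -[LHS]mulmx1 -[LHS](mul1mx _) -(sum_tproj R) mulmx_suml -sum_tweights.
apply: eq_bigr => a _; rewrite mulmxA mulmx_sumr.
by [].
Qed.

Lemma gm_conj R (z : 'rV[R]_r) (A : 'M[R]_N) : gm_point z ->
  gm_eval phi z *m A *m invmx (gm_eval phi z) =
  \sum_(d <- tweights) monomial_at d z *: tcomp d A.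
Proof.
move=> Uz; rewrite invmx_gm_eval // gm_evalE !mulmx_suml.
transitivity (\sum_(a <- tchars) \sum_(b <- tchars)
    monomial_at (a - b) z *: (base R (tproj a) *m A *m base R (tproj b))).
  apply: eq_bigr => a _; rewrite mulmx_sumr; apply: eq_bigr => b _.
  by rewrite -!scalemxAl -scalemxAr scalerA monomial_atB.
rewrite sum_tweights; apply: eq_bigr => d _; rewrite /tcomp scaler_sumr.
apply: eq_bigr => a _; rewrite scaler_sumr; apply: eq_bigr => b /eqP <-.
by [].
Qed.

Lemma gm_eval_tcomp R (z : 'rV[R]_r) d (A : 'M[R]_N) : gm_point z ->
  gm_eval phi z *m tcomp d A *m invmx (gm_eval phi z) = monomial_at d z *: tcomp d A.
Proof.
move=> Uz; set g := gm_eval phi z.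
have gP a : a \in tchars -> g *m base R (tproj a) = monomial_at a z *: base R (tproj a).
  by rewrite /g gm_evalE; apply: (lincomb_tproj (fun a => monomial_at a z)).
have Pg a : a \in tchars ->
    base R (tproj a) *m invmx g = (monomial_at a z)^-1 *: base R (tproj a).
  by rewrite /g invmx_gm_eval //; apply: (tproj_lincomb (fun a => (monomial_at a z)^-1)).
rewrite /tcomp mulmx_sumr mulmx_suml scaler_sumr; apply: eq_big_seq => a aS.
rewrite mulmx_sumr mulmx_suml scaler_sumr big_seq_cond [RHS]big_seq_cond.
apply: eq_bigr => b /andP[bS /eqP <-].
rewrite !mulmxA gP // -mulmxA Pg //.
by rewrite -!scalemxAl -!scalemxAr scalerA monomial_atB.
Qed.

End Torus.

(** * Weight components and the Lie algebra of the torus *)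

Section TorusLie.
Variables (k : fieldType) (N r : nat) (T : alg_group k N) (phi : gm_morphism k N r).
Hypothesis T_iso : torus_iso T phi.
Local Notation F := (laurent k).
Local Notation dmx := (map_mx (@lderiv k)).
Local Notation base R M := (map_mx (in_alg R) M).
Local Notation tchars := (tchars phi).
Local Notation tproj := (tproj phi).
Local Notation tcomp := (tcomp phi).
Local Notation tweights := (tweights phi).
Implicit Types (a b d nu : 'rV[int]_r) (R : comUnitAlgType k).

(** The form of [tcomp] that acts on single coefficients of Laurent matrices; it avoids viewing k as
    an algebra over itself. *)
Definition tcompk d (Y : 'M[k]_N) : 'M[k]_N :=
  \sum_(a <- tchars) \sum_(b <- tchars | a - b == d) tproj a *m Y *m tproj b.

Lemma base_tcompk R d (Y : 'M[k]_N) : base R (tcompk d Y) = tcomp d (base R Y).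
Proof.
rewrite raddf_sum; apply: eq_bigr => a _ /=.
by rewrite raddf_sum; apply: eq_bigr => b _; rewrite /= !map_mxM.
Qed.

Lemma mxcoef_tcomp j d (A : 'M[F]_N) : mxcoef j (tcomp d A) = tcompk d (mxcoef j A).
Proof.
rewrite mxcoef_sum; apply: eq_bigr => a _.
rewrite mxcoef_sum; apply: eq_bigr => b _.
by rewrite (mxcoef_Malg (base F (tproj a) *m A)) (mxcoef_algM (tproj a) A).
Qed.

(** Conjugation by nu(t), with nu separating the weights, takes Y to the sum of the t^<nu, d> Y_d.
    So each component Y_d is a coefficient of an element of W (x) F. *)
Lemma tcompk_mem (W : 'M[k]_N -> Prop) d (Y : 'M[k]_N) : W 0 ->
  (forall (g A : 'M[F]_N), points T g -> overF W A -> overF W (g *m A *m invmx g)) ->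
  d \in tweights -> W Y -> W (tcompk d Y).
Proof.
move=> W0 WT dS WY; have [nu nu_inj] := separating_cochar tweights.
have [phiT _ _ _] := T_iso F; have Uz := gm_mono_point k nu.
have := WT _ _ (phiT _ Uz) (overF_alg W0 WY) (pairing nu d).
rewrite (gm_conj T_iso) // mxcoef_sum; congr W.
rewrite -[RHS](sum_pick (tcompk d Y) (undup_uniq _) dS).
apply: eq_big_seq => d' d'S; rewrite monomial_at_mono -base_tcompk mxcoef_lmonoZ.
have [<-|dd'] := eqVneq d d'; first by rewrite eqxx.
by rewrite ifN //; apply: contra dd' => /eqP/nu_inj ->.
Qed.

(** The component lies in Lie(U) by [tcompk_mem], so if it were nonzero it would be a weight vector
    for d. *)
Lemma tcompk_weight U d (Y : 'M[k]_N) : normalizes T U -> d \in tweights ->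
  Lie U Y -> ~ is_weight phi U d -> tcompk d Y = 0.
Proof.
move=> nTU dS YU; apply: contra_notP => /eqP Yd; exists (tcompk d Y) => //; split.
  have [U0 _ _] := subspace_Lie U.
  by apply: (tcompk_mem (W := Lie U)) => // g A Tg AU; apply: (LieF_Ad nTU Tg AU).
by move=> R z Uz; rewrite base_tcompk (gm_eval_tcomp T_iso).
Qed.

(* The pairing of a character with an element of Lie(T) (x) R. *)
Definition cpair R (c : 'rV[R]_r) a : R := \sum_(i < r) (a 0 i)%:~R * c 0 i.

Definition gm_diffR R (c : 'rV[R]_r) : 'M[R]_N :=
  \sum_(a <- tchars) cpair c a *: base R (tproj a).

Lemma gm_diffE (c : 'rV[k]_r) :
  gm_diff phi c = \sum_(a <- tchars) (\sum_(i < r) (a 0 i)%:~R * c 0 i) *: tproj a.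
Proof.
rewrite /gm_diff sum_phi; apply: eq_bigr => a _; rewrite scaler_sumr.
by apply: eq_bigr => aM /eqP <-.
Qed.

Lemma lcoefM_alg (f : F) (e : k) j : (f * in_alg F e) j = f j * e.
Proof. by rewrite mulr_algr [RHS]mulrC. Qed.

Lemma lcoef_cpair (c : 'rV[F]_r) a j :
  cpair c a j = \sum_(i < r) (a 0 i)%:~R * mxcoef j c 0 i.
Proof.
rewrite lcoef_sum; apply: eq_bigr => i _.
by rewrite mxE -(rmorph_int (in_alg F)) mulrC lcoefM_alg mulrC.
Qed.

Lemma mxcoef_gm_diffR (c : 'rV[F]_r) j :
  mxcoef j (gm_diffR c) = gm_diff phi (mxcoef j c).
Proof.
rewrite gm_diffE mxcoef_sum; apply: eq_bigr => a _.
by apply/matrixP => x y; rewrite !mxE lcoefM_alg lcoef_cpair.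
Qed.

Lemma gm_eval_dual R (c : 'rV[R]_r) :
  gm_eval phi (map_mx (Dual 1) c : 'rV[dual R]_r) =
  1%:M + deps R *: map_mx (@dual_in k R) (gm_diffR c).
Proof.
rewrite gm_evalE -(sum_tproj T_iso) raddf_sum scaler_sumr -big_split.
apply: eq_bigr => a _ /=; rewrite monomial_at_dual map_mxZ map_in_alg_lrmorph.
by rewrite scalerA deps_mul_in -[X in X + _]scale1r -scalerDl; congr (_ *: _); congr Dual; rewrite /= ?addr0 ?add0r.
Qed.

Lemma gm_point_dual R (c : 'rV[R]_r) : gm_point (map_mx (Dual 1) c : 'rV[dual R]_r).
Proof.
move=> i; rewrite mxE; apply/unitrP; exists (Dual 1 (- c 0 i)).
by split; congr Dual; rewrite /= ?mul1r ?mulr1 // ?subrr // addNr.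
Qed.

Lemma gm_eval_map R R' (f : {lrmorphism R -> R'}) (z : 'rV[R]_r) : gm_point z ->
  map_mx f (gm_eval phi z) = gm_eval phi (map_mx f z).
Proof.
move=> Uz; rewrite !gm_evalE raddf_sum; apply: eq_bigr => a _.
by rewrite /= map_mxZ map_in_alg_lrmorph monomial_at_map.
Qed.

(** The point 1 + eps A of T is phi(z) for some z over R[eps]. Modulo eps, injectivity of phi gives
    z = 1, so z = 1 + eps c, and c is the preimage of A. *)
Lemma LieR_torus R (A : 'M[R]_N) : LieR T A -> exists c : 'rV[R]_r, A = gm_diffR c.
Proof.
move=> /LieR_dual TA; have [_ _ _ phi_onto] := T_iso (dual R).
have [z Uz zA] := phi_onto _ TA.
have z1 : map_mx (@dre R) z = const_mx 1.
  have [_ _ phi_inj _] := T_iso R; apply: phi_inj.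
  - by move=> i; rewrite mxE; have := Uz i.
  - exact: gm_point1.
  by rewrite (gm_eval1 T_iso) -gm_eval_map // -zA map_mxD map_mx1 map_mxZ /= scale0r addr0.
exists (map_mx (@dep R) z).
have zE : z = map_mx (Dual 1) (map_mx (@dep R) z).
  apply/rowP => i; rewrite !mxE; have /rowP/(_ i) := z1; rewrite !mxE.
  by case: (z 0 i) => ? ? /= ->.
have := gm_eval_dual (map_mx (@dep R) z); rewrite -zE -zA => /addrI.
move=> /(congr1 (map_mx (@dep R))) E; apply/matrixP => x y.
by have /matrixP/(_ x y) := E; rewrite !mxE !deps_mul_in.
Qed.

(** phi is injective on the points 1 + eps c over the dual numbers. *)
Lemma gm_diff_inj (c c' : 'rV[k]_r) : gm_diff phi c = gm_diff phi c' -> c = c'.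
Proof.
move=> cc'; have [_ _ phi_inj _] := T_iso (dual k^o).
have E (x : 'rV[k]_r) : gm_diffR (x : 'rV[k^o]_r) = gm_diff phi x.
  rewrite gm_diffE; apply: eq_bigr => a _; congr (_ *: _).
  by apply/matrixP => i j; rewrite !mxE; apply: mulr1.
have := phi_inj _ _ (gm_point_dual (c : 'rV[k^o]_r)) (gm_point_dual (c' : 'rV[k^o]_r)).
rewrite !gm_eval_dual !E cc' => /(_ erefl) /rowP cE.
by apply/rowP => i; have := cE i; rewrite !mxE => -[].
Qed.

Lemma torus_bracket R (c : 'rV[R]_r) d (A : 'M[R]_N) :
  lie_bracket (gm_diffR c) (tcomp d A) = cpair c d *: tcomp d A.
Proof.
rewrite /lie_bracket /tcomp mulmx_sumr mulmx_suml scaler_sumr -sumrB.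
apply: eq_big_seq => a aS; rewrite mulmx_sumr mulmx_suml scaler_sumr -sumrB.
rewrite big_seq_cond [RHS]big_seq_cond; apply: eq_bigr => b /andP[bS /eqP <-].
rewrite !mulmxA (lincomb_tproj T_iso (cpair c)) // -[_ *m gm_diffR c]mulmxA (tproj_lincomb T_iso (cpair c)) //.
rewrite -!scalemxAl -!scalemxAr -scalerBl; congr (_ *: _).
by rewrite /cpair -sumrB; apply: eq_bigr => i _; rewrite !mxE rmorphB mulrBl.
Qed.

End TorusLie.

(** * Laurent series congruent to 1, and logarithmic derivatives *)

Section CongruenceToOne.
Variable k : fieldType.
Local Notation F := (laurent k).
Implicit Types (x y : F) (e : int).

Lemma lsuppD f g e : lsupp f e -> lsupp g e -> lsupp (f + g : F) e.
Proof. by move=> fe ge j je; rewrite /= fe ?ge ?addr0. Qed.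

Lemma lsuppN f e : lsupp f e -> lsupp (- f : F) e.
Proof. by move=> fe j je; rewrite /= fe ?oppr0. Qed.

Lemma lsupp1 : lsupp (1 : F) 0.
Proof. exact: lmono_supp. Qed.

(** For e > 0 this is the group 1 + t^e k[[t]], for e = 0 the group of units of k[[t]]. Listing the
    inverse makes the closure under inversion immediate. *)
Definition lunit1 e x := [/\ x \is a GRing.unit, lsupp (x - 1) e & lsupp (x^-1 - 1) e].

Lemma lsupp_sub1M e x y : 0 <= e -> lsupp (x - 1) e -> lsupp (y - 1) e ->
  lsupp (x * y - 1) e.
Proof.
move=> e0 xe ye; have -> : x * y - 1 = (x - 1) * y + (y - 1).
  by rewrite mulrBl mul1r addrA subrK.
apply: lsuppD => //; rewrite -[e]addr0; apply: lmul_supp => //.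
rewrite -[y](subrK 1); apply: lsuppD; last exact: lsupp1.
exact: lsuppW ye.
Qed.

Lemma lunit1M e x y : 0 <= e -> lunit1 e x -> lunit1 e y -> lunit1 e (x * y).
Proof.
move=> e0 [Ux xe xe'] [Uy ye ye']; split; first by rewrite unitrM Ux.
  exact: lsupp_sub1M.
by rewrite invrM // mulrC; apply: lsupp_sub1M.
Qed.

Lemma lunit1_1 e : lunit1 e 1.
Proof. by split; rewrite ?unitr1 ?invr1 ?subrr. Qed.

Lemma lunit1V e x : lunit1 e x -> lunit1 e x^-1.
Proof. by move=> [Ux xe xe']; split; rewrite ?unitrV ?invrK. Qed.

Lemma lunit1Xz e x (n : int) : 0 <= e -> lunit1 e x -> lunit1 e (x ^ n).
Proof.
move=> e0 xe; have nat_pow (y : F) (l : nat) : lunit1 e y -> lunit1 e (y ^+ l).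
  move=> ye; elim: l => [|l IHl]; first exact: lunit1_1.
  by rewrite exprS; apply: lunit1M.
case: n => n; first exact: nat_pow.
by rewrite NegzE -exprz_inv; apply/nat_pow/lunit1V.
Qed.

Lemma lderiv_exprz x c (n : int) : x \is a GRing.unit ->
  lderiv x = c * x -> lderiv (x ^ n) = n%:~R * c * x ^ n.
Proof.
move=> Ux dx.
have nat_pow (y d : F) (l : nat) : lderiv y = d * y ->
    lderiv (y ^+ l) = l%:R * d * y ^+ l.
  move=> dy; elim: l => [|l IHl].
    by rewrite expr0 !mul0r -[1](rmorph_nat (in_alg F) 1) lderiv_alg.
  rewrite exprS lderivM IHl dy -[l.+1]add1n natrD !mulrDl mul1r !mulrA.
  by congr (_ + _); rewrite -!mulrA mulrCA; congr (_ * _); rewrite mulrCA.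
case: n => n; first exact: nat_pow.
rewrite NegzE -exprz_inv rmorphN mulNr -mulrN; apply: nat_pow.
have := lderivM x x^-1; rewrite mulrV // -[1](rmorph_nat (in_alg F) 1) lderiv_alg.
move=> /esym/eqP; rewrite addrC addr_eq0 dx => /eqP E.
by apply: (mulrI Ux); rewrite E mulNr mulrN mulrA [x * c]mulrC.
Qed.

End CongruenceToOne.

(** * Exponentials of primitives in T(O) *)

Section TorusExp.
Variables (k : fieldType) (N r : nat) (T : alg_group k N) (phi : gm_morphism k N r).
Hypothesis natk : forall m : nat, m.+1%:R != 0 :> k.
Hypothesis T_iso : torus_iso T phi.
Local Notation F := (laurent k).
Local Notation dmx := (map_mx (@lderiv k)).

Lemma intk (j : int) : j != 0 -> j%:~R != 0 :> k.
Proof.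
by case: j => [[|n]|n] // _; rewrite ?natk // NegzE rmorphN oppr_eq0 natk.
Qed.

(** The exponential of a primitive of c. [ode_solve] applies to z - 1, a solution of X' - cX = c;
    there is no resonance because c(-1) = 0 and only degrees j > p >= 0 matter. *)
Lemma scalar_exp (c : F) (p : int) : 0 <= p -> lsupp c p ->
  exists z : F, lunit1 (p + 1) z /\ lderiv z = c * z.
Proof.
move=> p0.
have solve (c' : F) : lsupp c' p -> exists z : F, lsupp (z - 1) (p + 1) /\ lderiv z = c' * z.
  move=> c'p.
  have [||j jp|_ j pj|X [Xp _ XE]] := @ode_solve k 1 1 (fun _ => True) c' (const_mx c') p.
  - by [].
  - by [].
  - by apply/matrixP => x y; rewrite !mxE c'p.
  - by rewrite (c'p (-1)) ?intk //; lia.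
  exists (1 + X 0 0); split; first by rewrite addrAC subrr add0r; apply: mxsuppE.
  have /matrixP/(_ 0 0) := XE; rewrite !mxE => /eqP; rewrite subr_eq => /eqP dX.
  rewrite lderivD dX -[1](rmorph_nat (in_alg F) 1) lderiv_alg add0r rmorph_nat.
  by rewrite mulrDr mulr1.
move=> cp; have [z [zp dz]] := solve c cp; have [w [wp dw]] := solve (- c) (lsuppN cp).
(* The solution for -c is the inverse: (zw)' = 0 makes zw constant in characteristic 0, and zw = 1
   modulo t. *)
have zw : z * w = 1.
  have d0 : lderiv (z * w) = 0 by rewrite lderivM dz dw mulNr mulrN [z * _]mulrCA mulrA subrr.
  have zw1 : lsupp (z * w - 1) 1.
    by apply: (@lsuppW _ _ (p + 1)); [lia | apply: lsupp_sub1M => //; lia].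
  apply/eqP; rewrite -subr_eq0; apply/eqP/laurentP => j.
  case: (ltP j 1) => [/zw1 -> //|j1].
  have /(congr1 (fun f : F => f (j - 1))) := d0; rewrite /= subrK => /eqP.
  rewrite mulf_eq0 (negbTE (intk _)) /=; last by lia.
  by move=> /eqP ->; rewrite ifN ?subr0 //; lia.
have Uz : z \is a GRing.unit by apply/unitrPr; exists w.
have zV : z^-1 = w by apply: (mulrI Uz); rewrite mulrV.
by exists z; split=> //; split=> //; rewrite zV.
Qed.

Lemma monomial_at_lunit1 e (a : 'rV[int]_r) (z : 'rV[F]_r) : 0 <= e ->
  (forall i, lunit1 e (z 0 i)) -> lunit1 e (monomial_at a z).
Proof.
move=> e0 ze; apply: big_ind => [|x y xe ye|i _]; first exact: lunit1_1.
  exact: lunit1M.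
exact: lunit1Xz.
Qed.

Lemma mxsupp_alg m n (M : 'M[k]_(m, n)) : mxsupp 0 (map_mx (in_alg F) M).
Proof.
move=> j j0; apply/matrixP => x y; rewrite !mxE [GRing.in_alg F _]lalgE /=.
by rewrite ifN //; lia.
Qed.

Lemma lincomb_supp e (G : 'rV[int]_r -> F) : (forall a, lsupp (G a - 1) e) ->
  mxsupp e (\sum_(a <- tchars phi) G a *: map_mx (in_alg F) (tproj phi a) - 1%:M).
Proof.
move=> Ge; rewrite -(sum_tproj T_iso) -sumrB; apply: mxsupp_sum => a _.
rewrite -[X in _ - X]scale1r -scalerBl -[e]addr0.
by apply: mxsuppZ => //; apply: mxsupp_alg.
Qed.

(** x = phi(z) with z_i the exponential of a primitive of c_i. On the image of [tproj a], x acts by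
    the scalar a(z) and the differential of phi at c by <c, a>, and a(z)' = <c, a> a(z). *)
Lemma torus_exp (c : 'rV[F]_r) (p : int) : 0 <= p -> mxsupp p c ->
  exists x : 'M[F]_N, [/\ points T x, mxsupp (p + 1) (x - 1%:M),
    mxsupp (p + 1) (invmx x - 1%:M), dmx x = gm_diffR phi c *m x &
    forall c', x *m gm_diffR phi c' = gm_diffR phi c' *m x].
Proof.
move=> p0 cp; have cpi i : lsupp (c 0 i) p by apply: mxsuppE.
have /choice[z zP] i := scalar_exp p0 (cpi i).
pose w : 'rV[F]_r := \row_i z i; have Uw : gm_point w.
  by move=> i; rewrite mxE; have [[]] := zP i.
have p1 : 0 <= p + 1 by lia.
have wa a : lunit1 (p + 1) (monomial_at a w).
  by apply: monomial_at_lunit1 => // i; rewrite mxE; have [] := zP i.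
exists (gm_eval phi w); split.
- by have [phiT _ _ _] := T_iso F; apply: phiT.
- by rewrite gm_evalE; apply: lincomb_supp => a; have [] := wa a.
- by rewrite (invmx_gm_eval T_iso Uw); apply: lincomb_supp => a; have [] := wa a.
- rewrite gm_evalE dmx_sum mulmx_sumr; apply: eq_big_seq => a aS.
  rewrite dmxZ dmx_alg scaler0 addr0 -scalemxAr (lincomb_tproj T_iso (cpair c)) //.
  rewrite scalerA; congr (_ *: _); rewrite [RHS]mulrC.
  rewrite /monomial_at /cpair; apply: (big_ind2 (fun x y => lderiv x = y * x)).
  + by rewrite mul0r -[1](rmorph_nat (in_alg F) 1) lderiv_alg.
  + by move=> x1 y1 x2 y2 d1 d2; rewrite lderivM d1 d2 mulrDl -mulrA [x1 * (y2 * _)]mulrCA.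
  by move=> i _; rewrite mxE; have [[Uz _ _] dz] := zP i; apply: lderiv_exprz.
- move=> c'; rewrite gm_evalE mulmx_suml mulmx_sumr; apply: eq_big_seq => a aS.
  by rewrite -scalemxAl -scalemxAr (tproj_lincomb T_iso (cpair c')) ?(lincomb_tproj T_iso (cpair c')).
Qed.

End TorusExp.

(** * Reduction along the central series *)

Lemma invmx_mul (R : comUnitRingType) n (x y : 'M[R]_n) :
  x \in unitmx -> y \in unitmx -> invmx (x *m y) = invmx y *m invmx x.
Proof.
move=> Ux Uy; have Uxy : x *m y \in unitmx by rewrite unitmx_mul Ux.
rewrite -[RHS](mulKmx Uxy) -[LHS]mulmx1; congr (_ *m _).
by rewrite -mulmxA (mulKVmx Uy) mulmxV.
Qed.

Section Reduction.
Variables (k : fieldType) (N r : nat) (T U : alg_group k N) (phi : gm_morphism k N r).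
Hypothesis natk : forall m : nat, m.+1%:R != 0 :> k.
Hypothesis T_iso : torus_iso T phi.
Hypothesis nTU : normalizes T U.
Hypothesis U_unip : unipotent U.
Local Notation F := (laurent k).
Local Notation dmx := (map_mx (@lderiv k)).
Local Notation tcomp := (tcomp phi).

(** What [ode_solve] requires of g = <c, d> for every weight d on Lie(U). Weights for which g has a
    pole of order at least 2 impose no condition. *)
Definition nonresonant (c : 'rV[F]_r) (e : int) : Prop :=
  forall d, is_weight phi U d -> (forall i, i < -1 -> cpair c d i = 0) ->
  forall j : int, e < j -> j%:~R != cpair c d (-1).

Lemma supp_tcomp e d (A : 'M[F]_N) : mxsupp e A -> mxsupp e (tcomp d A).
Proof.
move=> Ae j je; rewrite mxcoef_tcomp Ae // /tcompk big1 // => a _; rewrite big1 // => b _.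
by rewrite mulmx0 mul0mx.
Qed.

Lemma dmx_tcomp d (A : 'M[F]_N) : dmx (tcomp d A) = tcomp d (dmx A).
Proof.
rewrite dmx_sum; apply: eq_bigr => a _; rewrite dmx_sum; apply: eq_bigr => b _.
by rewrite !dmxM !dmx_alg mulmx0 addr0 mul0mx add0r.
Qed.

Lemma tcompD d (A B : 'M[F]_N) : tcomp d (A + B) = tcomp d A + tcomp d B.
Proof.
rewrite /tcomp -big_split; apply: eq_bigr => a _ /=; rewrite -big_split.
by apply: eq_bigr => b _ /=; rewrite mulmxDr mulmxDl.
Qed.

Lemma tcompZ d (f : F) (A : 'M[F]_N) : tcomp d (f *: A) = f *: tcomp d A.
Proof.
rewrite /tcomp scaler_sumr; apply: eq_bigr => a _; rewrite scaler_sumr.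
by apply: eq_bigr => b _ /=; rewrite -scalemxAr -scalemxAl.
Qed.

Lemma central_ode i c e (D : 'M[F]_N) : nonresonant c e ->
  overF (lie_central U i) D -> mxsupp e D ->
  exists X, [/\ mxsupp (e + 1) X, overF (lie_central U i) X &
                dmx X - lie_bracket (gm_diffR phi c) X = D].
Proof.
move=> res DW De; have WS := subspace_central U i.
(* For each weight the scalar equation is solved with all of D on the right; the projection to the
   weight component follows, since it commutes with d/dt. *)
have /choice[X XP] d : exists X, is_weight phi U d ->
    [/\ mxsupp (e + 1) X, overF (lie_central U i) X & dmx X - cpair c d *: X = D].
  have [wd|] := pselect (is_weight phi U d); last by exists 0.
  by have [X XP] := ode_solve WS DW De (res d wd); exists X.
pose P d := `[< is_weight phi U d >].
exists (\sum_(d <- tweights phi | P d) tcomp d (X d)); split.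
- by apply: mxsupp_sum => d /asboolP/XP[Xe _ _]; apply: supp_tcomp.
- rewrite big_seq_cond; apply: overF_sum => // d /andP[dS /asboolP/XP[_ XW _]] j.
  rewrite mxcoef_tcomp; apply: (tcompk_mem T_iso) => //; first by case: WS.
  by move=> g A Tg; apply: central_Ad Tg.
rewrite dmx_sum [lie_bracket _ _](_ : _ =
   \sum_(d <- tweights phi | P d) lie_bracket (gm_diffR phi c) (tcomp d (X d))); last first.
  by rewrite /lie_bracket mulmx_sumr mulmx_suml sumrB.
(* Of the weights of T on all matrices, those that are not weights on Lie(U) contribute nothing to
   D. *)
rewrite -sumrB [RHS](sum_tcomp T_iso) [RHS](bigID P) /= [X in _ = _ + X]big1_seq; last first.
  move=> d /andP[/asboolPn wd dS]; apply: mxP => j; rewrite mxcoef_tcomp mxcoef0.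
  exact: (tcompk_weight T_iso nTU dS (central_Lie (DW j))).
rewrite addr0; apply: eq_bigr => d /asboolP/XP[_ _ XE].
rewrite (torus_bracket T_iso) dmx_tcomp -tcompZ -XE tcompD; congr (_ + _).
by rewrite -scaleN1r -tcompZ scaleN1r.
Qed.

Lemma lsupp_ifact i : lsupp (ifact F i) 0.
Proof.
have -> : ifact F i = (ifact k i)%:A; last by rewrite lalgE; apply: lmono_supp.
by rewrite /ifact -in_algE fmorphV rmorph_nat.
Qed.

(** Here A + E = B + [X, A], so what remains of the difference consists of brackets with X; these
    lie one term lower in the central series. The bracket of X in t^(e+1) with A in t^(-s-1) loses
    s; the further brackets with X lose nothing more, as e >= 0. *)
Lemma gauge_step i c e s (A B : 'M[F]_N) : 0 <= s -> 0 <= e -> nonresonant c e ->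
  LieF U A -> LieF U B -> mxsupp (- s - 1) A ->
  overF (lie_central U i.+1) (B - A) -> mxsupp e (B - A) ->
  exists X A', [/\ mxsupp (e + 1) X, LieF U X,
    gauge (mexp N X) (gm_diffR phi c + A) = gm_diffR phi c + A',
    overF (lie_central U i) (B - A') & mxsupp (e - s) (B - A')].
Proof.
move=> s0 e0 res AU BU As DW De.
have [X [Xe XW XE]] := central_ode res DW De.
have XU : LieF U X by move=> j; apply: central_Lie (XW j).
have LS := subspace_Lie U; have WS := subspace_central U i.
have bracketU (Y : 'M[F]_N) : LieF U Y -> LieF U (lie_bracket X Y).
  by apply: (overF_bracket (W1 := Lie U) (W2 := Lie U)) => // M M'; apply: Lie_bracket.
have bracketW (Y : 'M[F]_N) : LieF U Y -> overF (lie_central U i) (lie_bracket X Y).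
  by apply: (overF_bracket (W1 := lie_central U i.+1) (W2 := Lie U)) => // M M' [_]; apply.
have bracketS (Y : 'M[F]_N) : mxsupp (e - s) Y -> mxsupp (e - s) (lie_bracket X Y).
  by move=> Ye; apply: mxsuppW (mxsupp_bracket Xe Ye); lia.
set D := B - A in DW De XE; pose E := D + lie_bracket X A.
have EE : dmx X + lie_bracket X (gm_diffR phi c + A) = E.
  by rewrite lie_bracketDr addrA /E -XE; congr (_ + _ + _); rewrite /lie_bracket opprB.
have XAs : mxsupp (e - s) (lie_bracket X A).
  by apply: mxsuppW (mxsupp_bracket Xe As); lia.
have EU j : LieF U (iter j (lie_bracket X) E).
  elim: j => [|j IHj] /=; last exact: bracketU.
  by apply: (overFD LS); [apply: (overFB LS) | apply: bracketU].
have Es j : mxsupp (e - s) (iter j (lie_bracket X) E).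
  elim: j => [|j IHj] /=; last exact: bracketS.
  by apply: mxsuppD XAs; apply: mxsuppW De; lia.
(* The term of index 0 in [gauge_mexp] is E itself; [S] is the rest, which has at least one bracket
   in every term. *)
pose S := \sum_(j < N + N) ifact F j.+2 *: iter j.+1 (lie_bracket X) E.
have BE : B - (A + E + S) = - (lie_bracket X A + S).
  have -> : A + E = B + lie_bracket X A by rewrite /E /D addrA [A + _]addrC subrK.
  by rewrite -addrA opprD addrA subrr add0r.
have XN : X ^+ N = 0 by apply: (unipotent_nil natk U_unip); apply/LieFE.
exists X, (A + E + S); split; [exact: Xe | exact: XU | | |].
- rewrite (gauge_mexp natk _ XN) EE addnS big_ord_recl.
  rewrite [ifact F _](_ : _ = 1) ?scale1r; last by rewrite /ifact factS fact0 muln1 invr1.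
  rewrite -[_ + A + _]addrA -[A + E + S]addrA; congr (_ + (_ + (_ + _))).
- rewrite BE; apply: (overFN WS); apply: (overFD WS); first exact: (bracketW _ AU).
  rewrite /S; apply: (overF_sum _ WS) => j _; apply: (overFZ _ WS); exact: (bracketW _ (EU j)).
- rewrite BE; apply: mxsuppN; apply: (mxsuppD XAs); rewrite /S; apply: mxsupp_sum => j _.
  rewrite -[e - s]add0r; apply: mxsuppZ; [exact: lsupp_ifact | exact: (Es j.+1)].
Qed.

(** For e >= 0, the kernel of H(O) -> H(O/t^e), inside H(F). *)
Definition congruence_point (H : alg_group k N) (e : int) (x : 'M[F]_N) : Prop :=
  [/\ points H x, mxsupp e (x - 1%:M) & mxsupp e (invmx x - 1%:M)].

Lemma mxsupp_sub1 e (x : 'M[F]_N) : 0 <= e -> mxsupp e (x - 1%:M) -> mxsupp 0 x.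
Proof.
move=> e0 xe; rewrite -[x](subrK 1%:M); apply: mxsuppD; last exact: mxsupp1.
exact: mxsuppW xe.
Qed.

Lemma mxsupp_sub1M e (x y : 'M[F]_N) : 0 <= e ->
  mxsupp e (x - 1%:M) -> mxsupp e (y - 1%:M) -> mxsupp e (x *m y - 1%:M).
Proof.
move=> e0 xe ye; have -> : x *m y - 1%:M = (x - 1%:M) *m y + (y - 1%:M).
  by rewrite mulmxBl mul1mx addrA subrK.
apply: mxsuppD => //; rewrite -[e]addr0; apply: mxsuppM => //.
exact: mxsupp_sub1 ye.
Qed.

Lemma congruence_pointM H e (x y : 'M[F]_N) : 0 <= e ->
  congruence_point H e x -> congruence_point H e y -> congruence_point H e (x *m y).
Proof.
move=> e0 [Hx xe xe'] [Hy ye ye']; split; first exact: pointsM.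
  exact: mxsupp_sub1M.
have [[Ux _] [Uy _]] := (Hx, Hy); rewrite (invmx_mul Ux Uy).
exact: mxsupp_sub1M.
Qed.

Lemma congruence_pointW H e e' (x : 'M[F]_N) : e' <= e ->
  congruence_point H e x -> congruence_point H e' x.
Proof. by move=> ee [Hx xe xe']; split=> //; apply: mxsuppW ee _. Qed.

Lemma congruence_point_integral H e (x : 'M[F]_N) : 0 <= e ->
  congruence_point H e x -> integral_point H x.
Proof.
by move=> e0 [Hx xe xe']; split=> //; [apply: mxsupp_sub1 xe | apply: mxsupp_sub1 xe'].
Qed.

Lemma mxsupp_congr e (x y : 'M[F]_N) : mxsupp e (x - y) <-> mx_congr e x y.
Proof.
split=> xy j je; last by rewrite mxcoefB xy // subrr.
by apply/eqP; rewrite -subr_eq0 -mxcoefB xy.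
Qed.

Lemma mexp_congr M e (X : 'M[F]_N) : 0 <= e -> X ^+ M = 0 -> mxsupp e X ->
  mxsupp e (mexp M X - 1%:M).
Proof.
move=> e0 XM Xe; have Xi i : mxsupp 0 (X ^+ i) /\ mxsupp e (X ^+ i.+1).
  elim: i => [|i [IH0 IHe]]; first by rewrite expr0 expr1; split=> //; apply: mxsupp1.
  split; first exact: mxsuppW IHe.
  by rewrite exprS -[e]addr0; apply: mxsuppM => //; apply: mxsuppW IHe.
rewrite -(mexp_widen XM (leqnSn M)) /mexp big_ord_recl /= expr0.
rewrite [ifact F _](_ : _ = 1) ?scale1r; last by rewrite /ifact fact0 invr1.
rewrite addrAC subrr add0r; apply: mxsupp_sum => i _; rewrite /bump /= add1n.
by rewrite -[e]add0r; apply: mxsuppZ; [apply: lsupp_ifact | have [] := Xi i].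
Qed.

Lemma mexp_congruence_point e (X : 'M[F]_N) : 0 <= e -> LieF U X -> mxsupp e X ->
  congruence_point U e (mexp N X).
Proof.
move=> e0 XU Xe; have XU' := (LieFE U X).1 XU.
have XN := unipotent_nil natk U_unip XU'.
split; first exact: (exp_point natk U_unip).
  exact: mexp_congr.
rewrite (invmx_mexp (natF natk) XN); apply: mexp_congr => //; last exact: mxsuppN.
by rewrite exprNn XN mulr0.
Qed.

(** Of the i steps the last one leaves no difference, so only i - 1 losses of s must be covered by
    e; the guard excludes i = 0, where the predecessor is truncated. Every step takes place at an
    order at least e0, so nonresonance beyond e0 serves them all and each factor exp(X) is 1 modulo
    t^(e0+1). *)
Lemma gauge_reduction i c e e0 s (A B : 'M[F]_N) : 0 <= s -> 0 <= e0 ->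
  nonresonant c e0 -> LieF U A -> LieF U B -> mxsupp (- s - 1) A ->
  overF (lie_central U i) (B - A) -> mxsupp e (B - A) ->
  ((0 < i)%N -> e0 + i.-1%:Z * s <= e) ->
  exists2 x, congruence_point U (e0 + 1) x &
    gauge x (gm_diffR phi c + A) = gm_diffR phi c + B.
Proof.
move=> s0 e00 res; elim: i e A => [|i IHi] e A AU BU As DW De ei.
  have -> : A = B.
    by apply: mxP => j; apply/esym/eqP; rewrite -subr_eq0 -mxcoefB DW.
  exists 1%:M; last by rewrite /gauge dmx1 invmx1 mul1mx mul0mx mulmx1 addr0.
  by split; rewrite ?invmx1 ?subrr; [exact: points1 | exact: mxsupp0 | exact: mxsupp0].
have {}ei := ei isT; have ie : 0 <= i%:Z * s by rewrite mulr_ge0.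
rewrite /= in ei; have ee0 : e0 <= e by lia.
have res' : nonresonant c e by move=> d wd g j ej; apply: (res d wd g); lia.
have [|X [A' [Xe XU gX A'W A'e]]] := gauge_step s0 _ res' AU BU As DW De; first by lia.
have A'U : LieF U A'.
  have -> : A' = B - (B - A') by rewrite opprB addrC subrK.
  apply: (overFB (subspace_Lie U)) => // j; exact: central_Lie (A'W j).
(* The pole bound survives the step: A' - A lies in t^(e-s), and e >= 0. *)
have A's : mxsupp (- s - 1) A'.
  have -> : A' = A + (B - A) - (B - A') by rewrite [A + _]addrC subrK opprB addrC subrK.
  by apply: mxsuppB; [apply: mxsuppD => // |]; [apply: mxsuppW De | apply: mxsuppW A'e]; lia.
have [|x xU gx] := IHi _ _ A'U BU A's A'W A'e.
  by case: i {IHi DW A'W} ei ie => // i ei ie _ /=; lia.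
have Xx : congruence_point U (e0 + 1) (mexp N X).
  apply: (@congruence_pointW _ (e + 1)); first by lia.
  by apply: mexp_congruence_point => //; lia.
exists (x *m mexp N X); first by apply: congruence_pointM => //; lia.
have [[[Ux _] _ _] [[UX _] _ _]] := (xU, Xx).
by rewrite (gaugeM _ Ux UX) gX.
Qed.

End Reduction.

(** * From the two reductions to the theorem *)

Section Assembly.
Variables (k : fieldType) (N r : nat) (G T U : alg_group k N) (phi : gm_morphism k N r).
Hypothesis natk : forall m : nat, m.+1%:R != 0 :> k.
Hypothesis T_iso : torus_iso T phi.
Hypothesis G_TU : semidirect G T U.
Hypothesis U_unip : unipotent U.
Local Notation F := (laurent k).
Local Notation dmx := (map_mx (@lderiv k)).

Lemma semidirect_normalizes : normalizes T U.
Proof.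
by move=> R g u Tg; have [TG _ nGU _] := G_TU R; apply: nGU; apply: TG.
Qed.

Lemma mxcoef_principal_part q (A : 'M[F]_N) j :
  mxcoef j (principal_part q A) =
  if (- q%:Z <= j) && (j < 0) then mxcoef j A else 0.
Proof.
rewrite mxcoef_sum; under eq_bigr do rewrite mxcoef_mono.
case: ifP => jq; last first.
  by rewrite big_nat big1 // => i iq; rewrite ifN //; apply/eqP; lia.
have js : - (`|j|%N)%:Z = j by lia.
rewrite (bigD1_seq `|j|%N) /=; [|by rewrite mem_index_iota; lia|exact: iota_uniq].
rewrite js eqxx big1 ?addr0 // => i ij; rewrite ifN //.
by apply: contra ij => /eqP ->; apply/eqP; lia.
Qed.

Section Residue.
Variables (pi : k -> rat) (pi_lin : Q_linear pi) (pi1 : pi 1 = 1).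
Variables (l : nat) (chi : 'I_l -> 'rV[int]_r) (chi_weights : weights phi U chi).
Variables (b : nat) (b_gt0 : (0 < b)%N) (mu : 'rV[int]_r).

Lemma pi_int (j : int) (x : k) : pi (j%:~R * x) = j%:~R * pi x.
Proof.
have pi0 : pi 0 = 0.
  have := pi_lin 1 0 0; rewrite mulr0 addr0 mul1r => /eqP.
  by rewrite -subr_eq0 opprD addNKr oppr_eq0 => /eqP.
by have := pi_lin j%:~R x 0; rewrite !addr0 pi0 addr0 ratr_int.
Qed.

Lemma pi_sum (I : finType) (f : I -> k) : pi (\sum_i f i) = \sum_i pi (f i).
Proof.
have piD x y : pi (x + y) = pi x + pi y.
  by have := pi_lin 1%:~R x y; rewrite ratr_int !mul1r.
apply: (big_morph pi piD); have := piD 0 0; rewrite addr0 => /eqP.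
by rewrite -subr_eq0 opprD addNKr oppr_eq0 => /eqP.
Qed.

(* A resonance j = <d, c_(-1)> is an integer, hence equals <mu, d> / b <= L. *)
Lemma residue_nonresonant (c : 'rV[F]_r) (e : int) :
  scaled_proj phi pi b (mxcoef (-1) (gm_diffR phi c)) mu ->
  (forall j : int, e < j -> max_weight b mu chi < j%:~R) ->
  nonresonant U phi c e.
Proof.
move=> [c0 cE muE] Le d wd _ j ej; apply: contraTneq (Le j ej) => jE.
have [_ /(_ d) [/(_ wd) [i di] _]] := chi_weights.
have c0E : c0 = mxcoef (-1) c.
  by apply: (gm_diff_inj T_iso); rewrite -cE mxcoef_gm_diffR.
have b0 : b%:R != 0 :> rat by rewrite pnatr_eq0 -lt0n.
have -> : j%:~R = (pairing mu (chi i))%:~R / b%:R :> rat; last first.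
  rewrite -leNgt; exact: (le_bigmax _ (fun i => (pairing mu (chi i))%:~R / b%:R : rat)).
apply: (mulIf b0); rewrite divfK // -[LHS]mulrC.
have := congr1 pi jE; rewrite -[j%:~R]mulr1 pi_int pi1 mulr1 => ->.
rewrite lcoef_cpair -c0E pi_sum mulr_sumr /pairing rmorph_sum.
apply: eq_bigr => x _ /=; rewrite pi_int intrM muE di.
by rewrite mulrCA mulrC.
Qed.
End Residue.

(** x is a solution of x' = (B - A) x that commutes with Lie(T) (x) F, so it takes A to B exactly
    and acts on the unipotent part by conjugation alone. As x = 1 modulo t^(p+1), this changes the
    unipotent part only from t^(p+1+m) on. *)
Lemma torus_reduction (p m : int) (A B AU : 'M[F]_N) : 0 <= p ->
  LieF T A -> LieF T B -> LieF U AU -> mxsupp p (B - A) -> mxsupp m AU ->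
  exists x, [/\ congruence_point T (p + 1) x, 
    LieF U (x *m AU *m invmx x), mxsupp m (x *m AU *m invmx x),
    mxsupp (p + 1 + m) (x *m AU *m invmx x - AU) &
    gauge x (A + AU) = B + x *m AU *m invmx x].
Proof.
move=> p0 AT BT AUU BAp AUm.
have [c cE] := LieR_torus T_iso ((LieFE T (B - A)).1 (overFB (subspace_Lie T) BT AT)).
have [cA cAE] := LieR_torus T_iso ((LieFE T A).1 AT).
have cp : mxsupp p c.
  move=> j jp; apply: (gm_diff_inj T_iso); rewrite -mxcoef_gm_diffR -cE BAp //.
  by rewrite /gm_diff big1 // => aM _; rewrite big1 ?scale0r // => i _; rewrite mxE mulr0.
have [x [Tx xp xp' dx xc]] := torus_exp natk T_iso p0 cp.
have p1 : 0 <= p + 1 by lia.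
have [Ux _] := Tx.
have [x0 x0'] := (mxsupp_sub1 p1 xp, mxsupp_sub1 p1 xp').
exists x; split; first by split.
- exact: LieF_Ad semidirect_normalizes Tx AUU.
- by rewrite -[m]addr0 -[m]add0r; apply: mxsuppM => //; apply: mxsuppM.
- have -> : x *m AU *m invmx x - AU =
    (x - 1%:M) *m AU *m invmx x + AU *m (invmx x - 1%:M).
    by rewrite mulmxBl mulmxBl mul1mx mulmxBr mulmx1 addrA subrK.
  apply: mxsuppD; last by rewrite addrC; apply: mxsuppM.
  by rewrite -[_ + m]addr0; apply: mxsuppM => //; apply: mxsuppM.
have xA : x *m A = A *m x by rewrite cAE xc.
have xV : x *m AU *m invmx x *m x = x *m AU := mulmxKV Ux _.
apply: (gauge_eqP Ux); rewrite mulmxDr dx -cE xA mulmxBl mulmxDl xV.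
by rewrite addrC addrA subrK.
Qed.

(** The numerical conditions: [- s - 1 <= m] bounds the pole of the unipotent part, [e <= p + 1 + m]
    keeps the torus step within the congruence modulo t^e, and [e0 + n%:Z * s <= e] covers n losses
    in n + 1 steps. Resonances concern B, the torus component once that step is done. *)
Lemma reduction n (p m e s e0 : int) (A B AU BU : 'M[F]_N) :
  upper_central_full U n.+1 -> 0 <= p -> 0 <= s -> 0 <= e0 ->
  LieF T A -> LieF T B -> LieF U AU -> LieF U BU ->
  mxsupp p (B - A) -> mxsupp m AU -> mxsupp e (BU - AU) ->
  - s - 1 <= m -> e <= p + 1 + m -> e0 + n%:Z * s <= e ->
  (forall c, B = gm_diffR phi c -> nonresonant U phi c e0) ->
  exists xT xU, [/\ congruence_point T (p + 1) xT, congruence_point U (e0 + 1) xU &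
    gauge (xU *m xT) (A + AU) = B + BU].
Proof.
move=> Un p0 s0 e00 AT BT AUU BUU BAp AUm De sm em e0e res.
have [xT [xTT CU Cm Ce gT]] := torus_reduction p0 AT BT AUU BAp AUm.
move: CU Cm Ce gT; set C := xT *m AU *m invmx xT => CU Cm Ce gT.
have [c cE] := LieR_torus T_iso ((LieFE T B).1 BT).
have DE : BU - C = (BU - AU) - (C - AU) by rewrite opprB addrA subrK.
have DU : overF (lie_central U n.+1) (BU - C).
  move=> j; apply: (nilpotent_Lie Un).
  exact: (overFB (subspace_Lie U) BUU CU j).
have Ds : mxsupp e (BU - C).
  by rewrite DE; apply: (mxsuppB De); apply: mxsuppW Ce.
have [xU xUU gU] := gauge_reduction natk T_iso semidirect_normalizes U_unip
  s0 e00 (res c cE) CU BUU (mxsuppW sm Cm) DU Ds (fun _ => e0e).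
exists xT, xU; split=> //; have [[[UU _] _ _] [[UT _] _ _]] := (xUU, xTT).
by rewrite (gaugeM _ UU UT) gT cE gU.
Qed.

End Assembly.

Theorem proposition5p2
  (k : closedFieldType) (char0 : [pchar k] =i pred0)
  (pi : k -> rat) (pi_lin : Q_linear pi) (pi1 : pi 1 = 1)
  (N r : nat) (G T U : alg_group k N) (phi : gm_morphism k N r) (n : nat)
  (G_TU : semidirect G T U) (T_torus : torus_iso T phi)
  (U_unip : unipotent U) (U_class : nilpotency_class U n)
  (l : nat) (chi : 'I_l -> 'rV[int]_r) (chi_weights : weights phi U chi)
  (q p : nat) (m : int) (AT AU : 'M[laurent k]_N)
  (AT_Lie : LieF T AT) (AU_Lie : LieF U AU)
  (AT_pole : forall j : int, j < - q%:Z -> mxcoef j AT = 0)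
  (AT_gap : forall j : int, 0 <= j < p%:Z -> mxcoef j AT = 0)
  (AU_supp : forall j : int, j < m -> mxcoef j AU = 0)
  (b : nat) (b_gt0 : (0 < b)%N) (mu : 'rV[int]_r)
  (mu_def : scaled_proj phi pi b (mxcoef (-1) AT) mu) :
  let A := AT + AU in
  let L := max_weight b mu chi in
  (L - 1 < m%:~R ->
     (exists2 x, integral_point G x & gauge x A = principal_part q AT) /\
     (exists xT xU,
        [/\ integral_point T xT, mx_congr (p%:Z + 1) xT 1%:M,
            integral_point U xU, mx_congr (m + 1) xU 1%:M &
            gauge (xU *m xT) A = principal_part q AT]))
  /\
  (* For m = 0 the second part fails for every G with L >= 1; such an A is
     covered by taking m = -1, since the coefficient of t^m may vanish. *)
  (m != 0 -> m%:~R <= L - 1 ->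
     (forall BT BU : 'M[laurent k]_N,
        LieF T BT -> LieF U BU ->
        (forall j : int, j < - q%:Z -> mxcoef j BT = 0) ->
        (forall j : int, j < m -> mxcoef j BU = 0) ->
        (forall j : int, - q%:Z <= j ->
           j%:~R < (n.+1%:Z * (`|m| - 1))%:~R + L -> mxcoef j BT = mxcoef j AT) ->
        (forall j : int, m <= j ->
           j%:~R < (n%:Z * (`|m| - 1))%:~R + L -> mxcoef j BU = mxcoef j AU) ->
        exists2 x, points G x & gauge x A = BT + BU) /\
     (forall (BT BU : 'M[laurent k]_N) (e : int),
        LieF T BT -> LieF U BU ->
        (n%:Z * (`|m| - 1))%:~R + L <= e%:~R ->
        mx_congr (e + `|m| - 1) AT BT ->
        mx_congr e AU BU ->
        exists x,
          [/\ integral_point G x,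
              mx_congr (e - n%:Z * `|m| + n%:Z + 1) x 1%:M &
              gauge x A = BT + BU])).
Proof.
move=> A L.
have natk i : i.+1%:R != 0 :> k by have /pcharf0P -> := char0.
have [Un _] := U_class.
have L0 : 0 <= L by apply: bigmax_ge_id.
have LT := subspace_Lie T; have LU := subspace_Lie U.
have T0 : LieF T 0 by apply: (overF0 LT).
have AUm : mxsupp m AU by [].
have res B c e : mxcoef (-1) B = mxcoef (-1) AT -> B = gm_diffR phi c ->
    (forall j, e < j -> L < j%:~R) -> nonresonant U phi c e.
  move=> BA Bc eL; apply: (residue_nonresonant T_torus pi_lin pi1 chi_weights b_gt0 _ eL).
  by rewrite -Bc BA.
have GT_points (x y : 'M[laurent k]_N) : points U x -> points T y -> points G (x *m y).
  move=> Ux Ty; have [TG UG _ _] := G_TU (laurent k).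
  exact: pointsM (UG _ Ux) (TG _ Ty).
have integral_GT (x y : 'M[laurent k]_N) :
    integral_point U x -> integral_point T y -> integral_point G (x *m y).
  move=> [Ux xi xi'] [Ty yi yi']; split; first exact: GT_points.
    exact: (mxsuppM (a := 0) (b := 0) xi yi).
  have [[ux _] [uy _]] := (Ux, Ty); rewrite (invmx_mul ux uy).
  exact: (mxsuppM (a := 0) (b := 0) yi' xi').
split.
- move=> Lm.
  have m0 : 0 <= m.
    suff : -1 < m by lia.
    by rewrite -(ltr_int rat); apply: le_lt_trans Lm; rewrite -[leLHS]sub0r lerB.
  set P := principal_part q AT.
  have PT : LieF T P.
    by move=> j; rewrite mxcoef_principal_part; case: ifP => // _; case: LT.
  have P1 : mxcoef (-1) P = mxcoef (-1) AT.
    rewrite mxcoef_principal_part; case: ifP => // q1.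
    by rewrite AT_pole //; lia.
  have PAp : mxsupp p%:Z (P - AT).
    move=> j jp; rewrite mxcoefB mxcoef_principal_part.
    case: ifP => jq; first by rewrite subrr.
    rewrite sub0r; apply/eqP; rewrite oppr_eq0; apply/eqP.
    by case: (ltP j 0) => j0; [apply: AT_pole; lia | apply: AT_gap; lia].
  have [xT [xU [xTT xUU gx]]] :
      exists xT xU, [/\ congruence_point T (p%:Z + 1) xT, congruence_point U (m + 1) xU &
        gauge (xU *m xT) (AT + AU) = P + 0].
    (* The unipotent target is 0, so the difference is -A^U in t^m. Since m >= 0 there is no loss, s
       = 0, and all orders can stay at m; integers beyond m exceed L because m + 1 > L. *)
    apply: (reduction natk T_torus G_TU U_unip Un (p := p%:Z) (m := m) (s := 0) (e := m)) => //.
    + exact: (overF0 LU).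
    + rewrite sub0r; exact: (mxsuppN AUm).
    + by lia.
    + by lia.
    + by lia.
    + move=> c Pc; apply: (res P c m P1 Pc) => j mj.
      apply: (@lt_le_trans _ _ ((m + 1)%:~R)); last by rewrite ler_int; lia.
      by rewrite intrD -ltrBlDr.
  rewrite addr0 in gx.
  have p1 : 0 <= p%:Z + 1 by lia.
  have m1 : 0 <= m + 1 by lia.
  have xTi := congruence_point_integral p1 xTT.
  have xUi := congruence_point_integral m1 xUU.
  have [[_ xTp _] [_ xUm _]] := (xTT, xUU).
  split; first by exists (xU *m xT) => //; apply: integral_GT.
  by exists xT, xU; split=> //; apply/mxsupp_congr.
move=> m0 mL; set s : int := `|m| - 1.
have s0 : 0 <= s by rewrite /s; lia.
have B_reduction : forall (BT BU : 'M[laurent k]_N) (e : int), LieF T BT -> LieF U BU ->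
    (n%:Z * s)%:~R + L <= e%:~R -> mx_congr (e + `|m| - 1) AT BT -> mx_congr e AU BU ->
    exists x, [/\ integral_point G x, mx_congr (e - n%:Z * `|m| + n%:Z + 1) x 1%:M &
      gauge x A = BT + BU].
  move=> BT BU e BTT BUU Le ABT ABU; pose e0 := e - n%:Z * s.
  have Le0 : L <= e0%:~R by rewrite intrB lerBrDl.
  have e00 : 0 <= e0 by rewrite -(ler_int rat); apply: le_trans L0 Le0.
  have ns0 : 0 <= n%:Z * s by rewrite mulr_ge0.
  have ee0 : e0 <= e by rewrite /e0; lia.
  have BAT : mxsupp (e + s) (BT - AT).
    by apply/mxsupp_congr => j je; rewrite ABT //; move: je; rewrite /s; lia.
  have BAU : mxsupp e (BU - AU) by apply/mxsupp_congr => j je; rewrite ABU.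
  (* The congruence reaches the residue because e + |m| - 1 >= 0; so mu, defined from A, also
     controls the resonances of B. *)
  have BT1 : mxcoef (-1) BT = mxcoef (-1) AT by rewrite ABT //; move: s0; rewrite /s; lia.
  have [xT [xU [xTT xUU gx]]] :
      exists xT xU, [/\ congruence_point T (e + s + 1) xT, congruence_point U (e0 + 1) xU &
        gauge (xU *m xT) (AT + AU) = BT + BU].
    (* With p = e + s, the torus step changes the unipotent part in t^(p+1+m), and p + 1 + m = e +
       |m| + m >= e. *)
    apply: (reduction natk T_torus G_TU U_unip Un (p := e + s) (m := m) (s := s) (e := e)) => //.
    + by lia.
    + by rewrite /s; lia.
    + by rewrite /s; lia.
    + by rewrite /e0 subrK.
    + move=> c Bc; apply: (res BT c e0 BT1 Bc) => j ej.
      by apply: (le_lt_trans Le0); rewrite ltr_int.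
  have e01 : 0 <= e0 + 1 by lia.
  have xTe0 : congruence_point T (e0 + 1) xT by apply: congruence_pointW xTT; lia.
  exists (xU *m xT); split=> //.
    by apply: integral_GT; [apply: congruence_point_integral xUU | apply: congruence_point_integral xTe0].
  apply/mxsupp_congr; have -> : e - n%:Z * `|m| + n%:Z + 1 = e0 + 1.
    by rewrite /e0 /s mulrBr mulr1 opprB addrA addrAC.
  by have [[_ xTe _] [_ xUe _]] := (xTe0, xUU); apply: mxsupp_sub1M.
split; last first.
  move=> BT BU e BTT BUU Le; exact: B_reduction.
move=> BT BU BTT BUU BTq BUm BTA BUA.
(* For integers j, j < e is equivalent to j < n(|m| - 1) + L, so the ranges of coefficients become
   congruences; below -q and m the coefficients of both connections vanish. *)
pose e := Num.ceil ((n%:Z * s)%:~R + L).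
have je j : (j < e) = (j%:~R < (n%:Z * s)%:~R + L) by rewrite /e -ceil_gt_int.
have [|||x [[Gx _ _] _ gx]] := B_reduction BT BU e BTT BUU.
- exact: Num.Theory.ceil_ge.
- move=> j jes; case: (ltP j (- q%:Z)) => jq; first by rewrite AT_pole ?BTq.
  (* The shift by s turns the bound ns + L into (n + 1)s + L. *)
  rewrite BTA // -/s; have : (j - s)%:~R < (n%:Z * s)%:~R + L.
    by rewrite -je; move: jes; rewrite /s; lia.
  rewrite intrB ltrBlDl addrA -intrD.
  by rewrite [n.+1%:Z]intS mulrDl mul1r.
- move=> j; rewrite je => jL; case: (ltP j m) => jm; first by rewrite AU_supp ?BUm.
  by rewrite BUA.
by exists x.
Qed.
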